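(* For every integer $n\ge1$ there are coefficients $a_i,b_i\in\mathbb{Z}[A^{\pm1}]$ such that in $\mathrm{KBSM}(S^1\times S^2)$ $$\left(1-A^{2n+4}\right)t^n=\begin{cases}\sum_{i=0}^{(n-2)/2}a_i\,t^{2i}, & n\text{ even},\\[2pt] \sum_{i=0}^{(n-3)/2}b_i\,t^{2i+1}, & n\text{ odd},\end{cases}$$ where $t^j$ denotes the closure of the mixed braid $t^j\in B_{1,1}$. In particular $(1-A^6)\,t=0$.
   Context: $\mathrm{KBSM}(M)$ is the free $\mathbb{Z}[A^{\pm1}]$-module on isotopy classes of unoriented framed links in $M$ modulo $L_+-AL_0-A^{-1}L_\infty$ and $L\sqcup O=(-A^2-A^{-2})L$. $S^1\times S^2$ is obtained from $S^3$ by $0$-surgery on the unknot; links in $S^1\times S^2$ are represented by links in the solid torus ST (complement of the surgery curve), and $\mathrm{KBSM}(S^1\times S^2)$ is the quotient of $\mathrm{KBSM}(\mathrm{ST})$ by the relations produced by band moves with the surgery curve. $B_{1,1}$ is the mixed braid group on one fixed and one moving strand, generated by the loop $t$ of the moving strand around the fixed one; the closures of $t^n$, $n\in\mathbb{N}$, form a basis of $\mathrm{KBSM}(\mathrm{ST})$ ($t^0$ being the unknot). *)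

(* Defs.v *)
From HB Require Import structures.
From mathcomp Require Import all_boot all_order all_algebra.
From mathcomp Require Import fraction.
From Stdlib Require List.
Set Implicit Arguments. Unset Strict Implicit. Unset Printing Implicit Defensive.
Import GRing.Theory.
Local Open Scope ring_scope.

(* Framed link diagrams in the annulus (ST = annulus x I, blackboard framing). *)
(* The angular coordinate of the annulus plays the role of "time"; at each time
   there are finitely many points of the diagram, at radial positions 0,1,...
   (0 = innermost, next to the removed surgery curve).  A diagram is the
   angular closure of a word of elementary slices:
   - [Cross i o] : the strands at positions i and i+1 swap; the strand going
                   from position i to position i+1 passes over iff [o];
   - [Cup i]     : a local minimum of the angle: two new points appear at
                   positions i, i+1 (points at positions >= i move by 2);
   - [Cap i]     : a local maximum: the points at positions i, i+1 are joined.
   Every framed link in ST is (up to framed isotopy) such a closure. *)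
Inductive slice := Cross of nat & bool | Cup of nat | Cap of nat.

Fixpoint wf_count (m : nat) (w : seq slice) : option nat :=
  match w with
  | [::] => Some m
  | Cross i _ :: w' => if (i.+1 < m)%N then wf_count m w' else None
  | Cup i :: w' => if (i <= m)%N then wf_count m.+2 w' else None
  | Cap i :: w' => if (i.+1 < m)%N then wf_count m.-2 w' else None
  end.

Definition closable (m : nat) (w : seq slice) : bool :=
  if wf_count m w is Some k then k == m else false.

(* ---- Kauffman states: each crossing smoothed.  For a crossing whose over-strand
   goes from top-left to bottom-right (o = true) the A-smoothing is the
   "cap-cup" smoothing, otherwise it is the vertical one (Kauffman's convention). *)
Fixpoint kstates (w : seq slice) : seq (nat * nat * seq slice) :=
  match w with
  | [::] => [:: (0%N, 0%N, [::])]
  | Cross i o :: w' =>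
      let S := kstates w' in
      [seq (x.1.1.+1, x.1.2, (if o then [:: Cap i; Cup i] else [::]) ++ x.2) | x <- S]
      ++ [seq (x.1.1, x.1.2.+1, (if o then [::] else [:: Cap i; Cup i]) ++ x.2) | x <- S]
  | s :: w' => [seq (x.1.1, x.1.2, s :: x.2) | x <- kstates w']
  end.

Inductive endp := Top of nat | Mid of nat.

Definition endp_eqb (x y : endp) : bool :=
  match x, y with
  | Top i, Top j => i == j
  | Mid i, Mid j => i == j
  | _, _ => false
  end.

(* state while sweeping: current point ids (in radial order), the other end of
   the arc through each current point, fresh counter, arcs joining two top
   points, number of closed circles already completed *)
Record sweep := Sweep {
  sw_cur : seq nat; sw_mate : nat -> endp; sw_fresh : nat;
  sw_tops : seq (nat * nat); sw_circ : nat }.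

Definition upd (f : nat -> endp) (a : nat) (v : endp) : nat -> endp :=
  fun x => if x == a then v else f x.

Definition sweep_step (s : sweep) (sl : slice) : sweep :=
  let: Sweep cur mate f tops circ := s in
  match sl with
  | Cross _ _ => s (* not used: words are crossingless here *)
  | Cup i =>
      Sweep (take i cur ++ [:: f; f.+1] ++ drop i cur)
            (upd (upd mate f (Mid f.+1)) f.+1 (Mid f)) f.+2 tops circ
  | Cap i =>
      let x := nth 0%N cur i in let y := nth 0%N cur i.+1 in
      let cur' := take i cur ++ drop i.+2 cur in
      if endp_eqb (mate x) (Mid y) then Sweep cur' mate f tops circ.+1 else
      match mate x, mate y with
      | Top j, Top j' => Sweep cur' mate f ((j, j') :: tops) circ
      | Top j, Mid v => Sweep cur' (upd mate v (Top j)) f tops circ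
      | Mid u, Top j => Sweep cur' (upd mate u (Top j)) f tops circ
      | Mid u, Mid v => Sweep cur' (upd (upd mate u (Mid v)) v (Mid u)) f tops circ
      end
  end.

Definition sweep_word (m : nat) (w : seq slice) : sweep :=
  foldl sweep_step (Sweep (iota 0 m) Top m [::] 0%N) w.

(* endpoints of the rectangle: (false, j) = top point j, (true, k) = bottom k *)
Definition partner (m : nat) (s : sweep) (e : bool * nat) : bool * nat :=
  let: (bot, j) := e in
  if bot then
    match sw_mate s (nth 0%N (sw_cur s) j) with
    | Top j' => (false, j')
    | Mid v => (true, index v (sw_cur s))
    end
  else
    match [seq p <- sw_tops s | (p.1 == j) || (p.2 == j)] with
    | p :: _ => (false, if p.1 == j then p.2 else p.1)
    | [::] => (true, find (fun v => endp_eqb (sw_mate s v) (Top j)) (sw_cur s))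
    end.

(* trace the closed component through top point [j0]; returns the list of top
   points visited and the winding number (closure arc bottom k -> top k counts +1) *)
Fixpoint trace (m : nat) (s : sweep) (j0 : nat) (fuel : nat) (here : bool * nat)
   (vis : seq nat) (wind : int) : seq nat * int :=
  match fuel with
  | 0%N => (vis, wind)
  | fuel'.+1 =>
      let: (bot, k) := partner m s here in
      let vis1 := if bot then vis else k :: vis in
      let arrive := (~~ bot, k) in
      let wind' := if bot then wind + 1 else wind - 1 in
      let vis2 := if bot then k :: vis1 else vis1 in
      if arrive == (false, j0) then (vis2, wind')
      else trace m s j0 fuel' arrive vis2 wind'
  end.

Fixpoint comps (m : nat) (s : sweep) (todo : seq nat) (vis : seq nat) (fuel : nat)
   : nat * nat :=
  match fuel with
  | 0%N => (0%N, 0%N)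
  | fuel'.+1 =>
    match todo with
    | [::] => (0%N, 0%N)
    | j :: todo' =>
        if j \in vis then comps m s todo' vis fuel' else
        let: (vis', w) := trace m s j (4 * m).+2 (false, j) (j :: vis) 0 in
        let: (c, e) := comps m s todo' vis' fuel' in
        if w == 0 then (c.+1, e) else (c, e.+1)
    end
  end.

Definition closure_count (m : nat) (w : seq slice) : nat * nat :=
  let s := sweep_word m w in
  let: (c, e) := comps m s (iota 0 m) [::] m.+1 in (c + sw_circ s, e)%N.

(* Kauffman bracket of the annular closure, with values in any commutative ring:
   A, Ai (= A^-1), delta = -A^2 - A^-2 for trivial circles, z for the core. *)
Definition abracket (R : comPzRingType) (A Ai z : R) (m : nat) (w : seq slice) : R :=
  \sum_(x <- kstates w)
     let: (c, e) := closure_count m x.2 in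
     A ^+ x.1.1 * Ai ^+ x.1.2 * (- A ^+ 2 - Ai ^+ 2) ^+ c * z ^+ e.

Definition KA := {fraction {poly int}}.
Definition Avar : KA := tofrac ('X : {poly int}).
Definition laurent (x : KA) : Prop :=
  exists (p : {poly int}) (k : nat), x = tofrac p / Avar ^+ k.

(* KBSM(ST) = Z[A^{+-1}][z] (z = core of ST); an element of {poly KA} lies in it
   iff all its coefficients are Laurent polynomials. *)
Definition in_KBSM_ST (p : {poly KA}) : Prop := forall i, laurent p`_i.

Definition skein (m : nat) (w : seq slice) : {poly KA} :=
  abracket (Avar%:P) ((Avar^-1)%:P) 'X m w.

(* ---- The closure of t^n in B_{1,1}: the curve going n times around the core
   (n >= 1), drawn as the closure of Cross 0, ..., Cross (n-2); its blackboard
   writhe -(n-1) is corrected to the framing 0 of the mixed-braid closure by the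
   unit (-A^3)^(n-1).  t^0 is the unknot (a trivial circle). *)
Definition spiral (n : nat) : seq slice := [seq Cross i true | i <- iota 0 n.-1].

Definition tclos (n : nat) : {poly KA} :=
  if n is 0%N then skein 0 [:: Cup 0; Cap 0]
  else (- Avar ^+ 3) ^+ n.-1 *: skein n (spiral n).

(* ---- Band moves with the surgery curve.  The 0-framed parallel of the surgery
   curve is the boundary of a meridian disk {theta0} x [r_in, r_out] x I of ST;
   drawn transversally it is a cup at the inner edge whose two arcs a, b travel
   outward, one over and one under all strands.  Band-summing it with the
   outermost strand (position m-1) yields the following word on m points
   ([v] chooses which arc passes over).  Every band move of a framed link in ST
   with the surgery curve is, up to isotopy, of this form at the start of some
   closable word. *)
Definition slide (m : nat) (v : bool) : seq slice :=
  Cup 0 :: [seq Cross i (~~ v) | i <- iota 1 m]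
       ++ [seq Cross i v | i <- iota 0 m] ++ [:: Cap m.-1].

Definition slide_rel (m : nat) (w : seq slice) (v : bool) : {poly KA} :=
  if (0 < m)%N && closable m w then skein m w - skein m (slide m v ++ w) else 0.

(* The submodule of KBSM(ST) generated over Z[A^{+-1}] by band-move relations;
   KBSM(S^1 x S^2) = KBSM(ST) / band_rels, so [band_rels p] means p = 0 in
   KBSM(S^1 x S^2). *)
Definition band_rels (p : {poly KA}) : Prop :=
  exists s : seq (KA * (nat * seq slice * bool)),
    List.Forall (fun x => laurent x.1) s /\
    p = \sum_(x <- s) x.1 *: slide_rel x.2.1.1 x.2.1.2 x.2.2.

(* Main.v *)
From HB Require Import structures.
Require Import Defs.
From mathcomp Require Import all_boot all_order all_algebra.
From mathcomp Require Import fraction ring zify.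
Set Implicit Arguments. Unset Strict Implicit. Unset Printing Implicit Defensive.
Import GRing.Theory.
Local Open Scope ring_scope.

(** Sliding the outermost of [n] parallel cores over the surgery curve gives the
    relation [z^n = skein n (slide n true)].  The coefficient of [z^n] on the
    right is [A^(2n+4)]: a Kauffman state contributes to it only if all its
    arcs go through, and such states are followed by tracking the position of
    the newborn cup while it is pushed outward and back.  All other terms have
    degree less than [n] and the parity of [n], because a simple closed curve in
    the annulus crosses a ray an odd number of times iff it is essential; and
    the constant term is divisible by the value of the unknot.  Since [t^n] is
    [(-A^2)^(n-1) z^n] plus lower terms of the same kind, the lower terms are
    combinations of the [t^i] with [i < n] of the parity of [n]. *)

(** * Planarity of the sweep *)

(** The exponent splits as $2n+4=n+(n+4)$. The outward row of crossings leaves the newborn cup at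
    position $k$ with weight $A^{n-2k}$; the returning row, summed over $k$ with the weights
    $A^{-2k}$, gives $A^{n+4}$, where the starting value $-A^3$ is the factor of a kink. The bracket
    is computed by a sweep and a tracing procedure, so planarity has to be carried along as a
    combinatorial invariant. It is quantified over all selections of arcs for two reasons: a cap
    changes which arcs exist, so a selection must be extendable backwards; and at the end the
    selection is a single component of the closure, whose arcs are known only once the diagram is
    complete. For each $n$ a single relation is enough: the band move on $n$ parallel cores,
    multiplied by $(-A^2)^{n-1}$ so that it cancels the $z^n$ term of $(1-A^{2n+4})t^n$ exactly. *)

Lemma endp_eqP : Equality.axiom endp_eqb.
Proof.
by case=> i [] j /=; apply: (iffP idP) => //= [/eqP->|[->]].
Qed.

HB.instance Definition _ := hasDecEq.Build endp endp_eqP.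

Lemma Mid_eq u v : (Mid u == Mid v) = (u == v). Proof. by []. Qed.

Definition before (v : nat) (l : seq nat) := take (index v l) l.

Lemma before_cat v l1 l2 :
  before v (l1 ++ l2) = if v \in l1 then before v l1 else l1 ++ before v l2.
Proof.
rewrite /before index_cat; case: ifPn => [v1|v1].
  by rewrite take_cat index_mem v1.
by rewrite take_cat ltnNge leq_addr /= addKn.
Qed.

Definition live (m : nat) (cur : seq nat) (x : endp) : bool :=
  match x with Top j => (j < m)%N | Mid v => v \in cur end.

(** Checkerboard colouring of the rectangle cut along the selected arcs: the value is the colour of
    the face just left of the end, negated on the lower edge. If arcs are oriented as boundaries of
    the faces of one colour, it tells whether the arc enters or leaves at this end. *)
Definition colour (chi : endp -> bool) (cur : seq nat) (x : endp) : bool :=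
  match x with
  | Top j => odd (count (chi \o Top) (iota 0 j))
  | Mid v => ~~ odd (count (chi \o Mid) (before v cur))
  end.

(* [M] is the pairing of the [m] top points and the current points given by the
   arcs drawn so far.  The last clause replaces the Jordan curve theorem: [chi]
   selects some of the arcs, and the two ends of a selected arc separate the
   other selected ends on the boundary of the rectangle into two even sets. *)
Record planar (m : nat) (s : sweep) (M : endp -> endp) : Prop := Planar {
  pl_uniq : uniq (sw_cur s);
  pl_fresh : forall v, v \in sw_cur s -> (v < sw_fresh s)%N;
  pl_live : forall x, live m (sw_cur s) x -> live m (sw_cur s) (M x);
  pl_invol : forall x, live m (sw_cur s) x -> M (M x) = x;
  pl_mate : forall v, v \in sw_cur s -> sw_mate s v = M (Mid v);
  pl_tops : forall j j', (j < m)%N ->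
    ((j, j') \in sw_tops s) || ((j', j) \in sw_tops s) = (M (Top j) == Top j');
  pl_topsm : forall p, p \in sw_tops s -> (p.1 < m)%N;
  pl_colour : forall chi : endp -> bool,
    (forall x, live m (sw_cur s) x -> chi (M x) = chi x) ->
    forall x, live m (sw_cur s) x -> chi x ->
    colour chi (sw_cur s) (M x) = ~~ colour chi (sw_cur s) x }.

Lemma planar_nofix m s M x : planar m s M -> live m (sw_cur s) x -> M x != x.
Proof.
move=> H lx; apply/eqP => E.
have := pl_colour H (chi := fun=> true) (fun _ _ => erefl) lx erefl.
by rewrite E; case: colour.
Qed.

Lemma planar_init m : exists M, planar m (sweep_word m [::]) M.
Proof.
exists (fun x => match x with Top j => Mid j | Mid j => Top j end).
rewrite /sweep_word /=; split=> //=.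
- exact: iota_uniq.
- by move=> v; rewrite mem_iota.
- by case=> i /=; rewrite mem_iota.
- by case.
move=> chi chiM.
have E j : (j < m)%N -> count (chi \o Mid) (before j (iota 0 m)) = count (chi \o Top) (iota 0 j).
  move=> jm; have -> : before j (iota 0 m) = iota 0 j.
    have := nth_iota 0 0 jm; rewrite /before add0n => {1}<-; rewrite index_uniq ?size_iota ?iota_uniq //.
    by rewrite take_iota (minn_idPl (ltnW jm)).
  apply: eq_in_count => i; rewrite mem_iota /= => ij.
  by rewrite -(chiM (Top i)) //=; apply: leq_trans ij _; exact: ltnW.
case=> j /=; first by move=> jm _; rewrite E.
by rewrite mem_iota /= => jm _; rewrite E // negbK.
Qed.

Lemma uniq_insert2 (l1 : seq nat) x y l2 : uniq (l1 ++ [:: x; y] ++ l2) =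
  [&& x != y, x \notin l1 ++ l2, y \notin l1 ++ l2 & uniq (l1 ++ l2)].
Proof. by rewrite uniq_catCA /= inE negb_or !andbA. Qed.

(** The neighbours [x] and [y] are both selected or both not, so they change each count by 0 or
    2. *)
Lemma colour_insert (chi : endp -> bool) l1 x y l2 z :
  chi (Mid x) = chi (Mid y) -> z != Mid x -> z != Mid y ->
  colour chi (l1 ++ [:: x; y] ++ l2) z = colour chi (l1 ++ l2) z.
Proof.
case: z => [//|v] exy vx vy /=.
rewrite !Mid_eq in vx vy.
rewrite !before_cat; case: ifP => // _.
by rewrite -[x :: y :: _]/([:: x; y] ++ _) before_cat !inE (negPf vx) (negPf vy) /=
   !count_cat /= exy; case: (chi _); rewrite ?add0n // !oddD /= negbK.
Qed.

Lemma colour_pair (chi : endp -> bool) l1 x y l2 :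
  uniq (l1 ++ [:: x; y] ++ l2) -> chi (Mid x) ->
  colour chi (l1 ++ [:: x; y] ++ l2) (Mid y) = ~~ colour chi (l1 ++ [:: x; y] ++ l2) (Mid x).
Proof.
rewrite uniq_insert2 !mem_cat !negb_or.
move=> /and4P[xy /andP[x1 _] /andP[y1 _] _] cx.
rewrite /colour !before_cat (negPf x1) (negPf y1) /before /= !eqxx (negPf xy) /= !inE !eqxx orbT.
by rewrite !count_cat /= cx !oddD /= addbF addbT.
Qed.

Lemma liveE m l1 x y l2 z :
  live m (l1 ++ [:: x; y] ++ l2) z = [|| z == Mid x, z == Mid y | live m (l1 ++ l2) z].
Proof.
case: z => //= v; rewrite !mem_cat !inE !Mid_eq.
by case: (v \in l1) => /=; rewrite ?orbT // -orbA.
Qed.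

Lemma take_drop2 (l : seq nat) i : (i.+1 < size l)%N ->
  l = take i l ++ [:: nth 0%N l i; nth 0%N l i.+1] ++ drop i.+2 l.
Proof.
move=> il; rewrite -{1}(cat_take_drop i l) (drop_nth 0%N); last exact: ltnW.
by rewrite (drop_nth 0%N il).
Qed.

Lemma planar_cup m s M i :
  planar m s M -> exists M', planar m (sweep_step s (Cup i)) M'.
Proof.
case: s => cur mate f tops circ H /=.
case: (H) => /= Hu Hf Hl Hi Hm Ht Htm Hc.
set a := f; set b := f.+1.
have fcur : forall v, v \in cur -> (v != a) * (v != b).
  by move=> v /Hf vf; rewrite !neq_ltn vf (ltnW (n := b)) ?ltnS // ltnW.
have acur : a \notin take i cur ++ drop i cur.
  by rewrite cat_take_drop; apply/negP => /Hf; rewrite ltnn.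
have bcur : b \notin take i cur ++ drop i cur.
  by rewrite cat_take_drop; apply/negP => /Hf; rewrite ltnNge leqnSn.
have ab : a != b by rewrite neq_ltn leqnn.
have nl z : live m cur z -> (z != Mid a) * (z != Mid b).
  by case: z => //= v /fcur.
pose M' z := if z == Mid a then Mid b else if z == Mid b then Mid a else M z.
have M'old z : live m cur z -> M' z = M z.
  by move=> /nl[za zb]; rewrite /M' (negPf za) (negPf zb).
have M'a : M' (Mid a) = Mid b by rewrite /M' eqxx.
have M'b : M' (Mid b) = Mid a.
  by rewrite /M' eqxx Mid_eq eq_sym (negPf ab).
have L z : live m (take i cur ++ [:: a; b] ++ drop i cur) z =
    [|| z == Mid a, z == Mid b | live m cur z].
  by rewrite liveE cat_take_drop.
have cu : uniq (take i cur ++ [:: a; b] ++ drop i cur).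
  by rewrite uniq_insert2 ab acur bcur cat_take_drop.
exists M'; split=> //=.
- move=> v; rewrite -/a -/b mem_cat !inE orbCA [X in _ || X]orbCA -mem_cat cat_take_drop.
  by case/or3P=> [/eqP->|/eqP->|/Hf h]; rewrite ?ltnS // ltnW // ltnW.
- move=> z; rewrite !L => /or3P[/eqP->|/eqP->|lz].
  + by rewrite M'a eqxx orbT.
  + by rewrite M'b eqxx.
  + by rewrite M'old // Hl // !orbT.
- move=> z; rewrite L => /or3P[/eqP->|/eqP->|lz].
  + by rewrite M'a M'b.
  + by rewrite M'b M'a.
  + by rewrite !M'old ?Hi ?Hl.
- move=> v; rewrite -[v \in _]/(live m _ (Mid v)) L /upd /M'.
  move=> /or3P[/eqP[->]|/eqP[->]|lz].
  + by rewrite !eqxx -[f == b]/(a == b) (negPf ab).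
  + by rewrite !eqxx Mid_eq eq_sym (negPf ab).
  + have [za zb] := nl _ lz; rewrite (negPf za) (negPf zb).
    rewrite !Mid_eq in za zb.
    by rewrite (negPf zb) -[v == f]/(v == a) (negPf za) Hm.
move=> chi chiM.
have cab : chi (Mid a) = chi (Mid b).
  by rewrite -M'b chiM // L eqxx orbT.
have H0 z : live m cur z -> chi z -> colour chi cur (M z) = ~~ colour chi cur z.
  by apply: Hc => x lx; rewrite -M'old // chiM // L lx !orbT.
have co z : live m cur z ->
   colour chi (take i cur ++ [:: a; b] ++ drop i cur) z = colour chi cur z.
  by move=> /nl[za zb]; rewrite colour_insert // cat_take_drop.
move=> z; rewrite L => /or3P[/eqP->|/eqP->|lz] cz.
- by rewrite M'a; apply: colour_pair.
- by rewrite M'b [X in ~~ X]colour_pair // ?negbK // cab.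
- by rewrite M'old // !co ?H0 // Hl.
Qed.

(** The cap either closes a circle or fuses the arcs ending at [x] and [y] into one. A selection of
    the new arcs is pulled back to the old ones: a closed circle is left unselected, and the two
    fused arcs are selected together, as the new arc is. *)
Lemma planar_cap m s M i : (i.+1 < size (sw_cur s))%N ->
  planar m s M -> exists M', planar m (sweep_step s (Cap i)) M'.
Proof.
case: s => cur mate f tops circ /= ilt H.
have nofix x := planar_nofix (x := x) H.
case: (H) => /= Hu Hf Hl Hi Hm Ht Htm Hc.
move: nofix => /= nofix.
set x := nth 0%N cur i; set y := nth 0%N cur i.+1.
set l1 := take i cur; set l2 := drop i.+2 cur.
have ecur : cur = l1 ++ [:: x; y] ++ l2 by exact: take_drop2.
have := Hu; rewrite ecur uniq_insert2 => /and4P[xy xl yl Hul].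
have L z : live m cur z = [|| z == Mid x, z == Mid y | live m (l1 ++ l2) z].
  by rewrite {1}ecur liveE.
have Lold z : live m (l1 ++ l2) z -> live m cur z.
  by move=> lz; rewrite L lz !orbT.
have Lx : live m cur (Mid x) by rewrite L eqxx.
have Ly : live m cur (Mid y) by rewrite L eqxx orbT.
have nl z : live m (l1 ++ l2) z -> (z != Mid x) * (z != Mid y).
  case: z => //= v lv; rewrite !Mid_eq; split; apply/eqP => E.
  - by rewrite -E lv in xl.
  - by rewrite -E lv in yl.
have co chi z : chi (Mid x) = chi (Mid y) -> live m (l1 ++ l2) z ->
    colour chi cur z = colour chi (l1 ++ l2) z.
  by move=> cxy /nl[zx zy]; rewrite {1}ecur colour_insert.
have [ex ey] : mate x = M (Mid x) /\ mate y = M (Mid y).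
  by split; apply: Hm.
have Linj u v : live m cur u -> live m cur v -> M u = M v -> u = v.
  by move=> lu lv E; rewrite -(Hi u lu) E Hi.
have frl v : v \in l1 ++ l2 -> (v < f)%N.
  by move=> lv; apply: Hf; exact: (Lold (Mid v)).
rewrite ex ey -[endp_eqb _ _]/(M (Mid x) == Mid y); case: eqVneq => [Mxy|nMxy].
  have Myx : M (Mid y) = Mid x by rewrite -Mxy Hi.
  have Lm z : live m (l1 ++ l2) z -> live m (l1 ++ l2) (M z).
    move=> lz; have := Hl _ (Lold _ lz); have [zx zy] := nl _ lz.
    rewrite L => /or3P[/eqP E|/eqP E|//].
    - by case/negP: zy; rewrite -(Hi z (Lold _ lz)) E Mxy.
    - by case/negP: zx; rewrite -(Hi z (Lold _ lz)) E Myx.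
  exists M; split=> //=.
  - by move=> z /Lold; apply: Hi.
  - by move=> v lv; apply: Hm; exact: (Lold (Mid v)).
  move=> chi chiM z lz cz.
  pose chi' w := if (w == Mid x) || (w == Mid y) then false else chi w.
  have chi'x : chi' (Mid x) = false by rewrite /chi' eqxx.
  have chi'y : chi' (Mid y) = false by rewrite /chi' eqxx orbT.
  have chi'o w : live m (l1 ++ l2) w -> chi' w = chi w.
    by move=> /nl[wx wy]; rewrite /chi' (negPf wx) (negPf wy).
  have cc w : live m (l1 ++ l2) w -> colour chi' (l1 ++ l2) w = colour chi (l1 ++ l2) w.
    case: w => [//|v] /= lw.
    congr (~~ odd _); apply: eq_in_count => k /mem_take kl.
    by rewrite /= chi'o.
  rewrite -!cc ?Lm // -!co ?chi'x ?chi'y ?Lm //.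
  apply: Hc; rewrite ?chi'o //; last exact: Lold.
  move=> w; rewrite L => /or3P[/eqP->|/eqP->|lw].
  - by rewrite Mxy chi'x.
  - by rewrite Myx chi'y.
  - by rewrite !chi'o ?Lm ?chiM.
have aL := Hl _ Lx; have bL := Hl _ Ly.
set a := M (Mid x) in ex nMxy aL *; set b := M (Mid y) in ey bL *.
have nMyx : b != Mid x.
  by apply: contra_neq nMxy => E; rewrite /a -E Hi.
have la : live m (l1 ++ l2) a.
  by move: aL; rewrite L (negPf nMxy) (negPf (nofix _ Lx)).
have lb : live m (l1 ++ l2) b.
  by move: bL; rewrite L (negPf nMyx) (negPf (nofix _ Ly)).
have ab : a != b.
  by apply/eqP => /(Linj _ _ Lx Ly)[E]; rewrite E eqxx in xy.
have Ma : M a = Mid x by exact: Hi.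
have Mb : M b = Mid y by exact: Hi.
pose M' z := if z == a then b else if z == b then a else M z.
have M'a : M' a = b by rewrite /M' eqxx.
have M'b : M' b = a by rewrite /M' eqxx eq_sym (negPf ab).
have M'o z : z != a -> z != b -> M' z = M z.
  by rewrite /M' => /negPf-> /negPf->.
have Mo z : live m (l1 ++ l2) z -> z != a -> z != b ->
    [/\ live m (l1 ++ l2) (M z), M z != a & M z != b].
  move=> lz za zb; have [zx zy] := nl _ lz; have lz' := Lold _ lz; split.
  - have := Hl _ lz'; rewrite L => /or3P[/eqP E|/eqP E|//].
    + by case/negP: za; rewrite /a -E Hi.
    + by case/negP: zb; rewrite /b -E Hi.
  - by apply: contra_neq zx => E; apply: Linj.
  - by apply: contra_neq zy => E; apply: Linj.
have M'l z : live m (l1 ++ l2) z -> live m (l1 ++ l2) (M' z).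
  move=> lz; have [->|za] := eqVneq z a; first by rewrite M'a.
  have [->|zb] := eqVneq z b; first by rewrite M'b.
  by rewrite M'o //; case: (Mo z lz za zb).
have M'i z : live m (l1 ++ l2) z -> M' (M' z) = z.
  move=> lz; have [->|za] := eqVneq z a; first by rewrite M'a.
  have [->|zb] := eqVneq z b; first by rewrite M'b.
  by have [_ h1 h2] := Mo z lz za zb; rewrite !M'o // Hi // Lold.
have M'c (chi : endp -> bool) :
  (forall z, live m (l1 ++ l2) z -> chi (M' z) = chi z) ->
  forall z, live m (l1 ++ l2) z -> chi z ->
  colour chi (l1 ++ l2) (M' z) = ~~ colour chi (l1 ++ l2) z.
  move=> chiM.
  have cab : chi a = chi b by rewrite -M'b chiM.
  pose chi' w := if (w == Mid x) || (w == Mid y) then chi a else chi w.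
  have chi'x : chi' (Mid x) = chi a by rewrite /chi' eqxx.
  have chi'y : chi' (Mid y) = chi a by rewrite /chi' eqxx orbT.
  have chi'o w : live m (l1 ++ l2) w -> chi' w = chi w.
    by move=> /nl[wx wy]; rewrite /chi' (negPf wx) (negPf wy).
  have cc w : live m (l1 ++ l2) w -> colour chi' (l1 ++ l2) w = colour chi (l1 ++ l2) w.
    case: w => [//|v] /= lw.
    congr (~~ odd _); apply: eq_in_count => k /mem_take kl.
    by rewrite /= chi'o.
  have chi'M w : live m cur w -> chi' (M w) = chi' w.
    rewrite L => /or3P[/eqP->|/eqP->|lw].
    - by rewrite -/a chi'o.
    - by rewrite -/b chi'y chi'o.
    - have [->|wa] := eqVneq w a; first by rewrite Ma chi'x chi'o.
      have [->|wb] := eqVneq w b; first by rewrite Mb chi'y chi'o.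
      by have [h _ _] := Mo w lw wa wb; rewrite !chi'o // -M'o // chiM.
  have H0 := Hc chi' chi'M.
  (* Along the path [a], [x], [y], [b] the colour flips three times: on each old arc by the
     invariant, and between the neighbours [x] and [y]. *)
  have cabx : chi a -> colour chi (l1 ++ l2) b = ~~ colour chi (l1 ++ l2) a.
    move=> ca; rewrite -!cc // -!co ?chi'x ?chi'y //.
    rewrite /a /b !H0 ?chi'x ?chi'y //; congr (~~ _).
    by rewrite [in LHS]ecur colour_pair -?ecur ?chi'x.
  move=> z lz cz; have [E|za] := eqVneq z a.
    by rewrite E M'a cabx // -E.
  have [E|zb] := eqVneq z b.
    by rewrite E M'b [in RHS]cabx ?negbK // cab -E.
  have [h _ _] := Mo z lz za zb.
  by rewrite M'o // -!cc // -!co ?chi'x ?chi'y // H0 ?chi'o // Lold.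
have mM v : v \in l1 ++ l2 -> mate v = M (Mid v).
  by move=> lv; apply: Hm; exact: (Lold (Mid v)).
(* Unless both fused arcs end at the top, no new arc between top points arises and the recorded list
   still describes [M']. *)
have tM k k' : (k < m)%N -> (forall j j', ~ (a = Top j /\ b = Top j')) ->
    ((k, k') \in tops) || ((k', k) \in tops) = (M' (Top k) == Top k').
  move=> km nab; rewrite Ht //.
  have [E|ka] := eqVneq (Top k) a.
    rewrite E Ma M'a; case Eb: b => [j|//].
    by case: (nab k j).
  have [E|kb] := eqVneq (Top k) b; last by rewrite M'o.
  rewrite E Mb M'b; case Ea: a => [j|//].
  by case: (nab j k).
case Ea : a => [j|u]; case Eb : b => [j'|v].
- have jm : (j < m)%N by have := la; rewrite Ea.
  have j'm : (j' < m)%N by have := lb; rewrite Eb.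
  have jj : j != j' by apply: contra_neq ab => E; rewrite Ea Eb E.
  exists M'; split=> //=.
  + by move=> w lw; rewrite mM // M'o // ?Ea ?Eb.
  + move=> k k' km; rewrite !inE -!pair_eqE /= orbACA Ht //.
    have [->|kj] := eqVneq k j.
      rewrite -[in RHS]Ea M'a Eb -Ea Ma orbF (negPf jj) andbF orbF.
      by rewrite -[RHS]/(j' == k') eq_sym.
    have [->|kj'] := eqVneq k j'.
      rewrite -[in RHS]Eb M'b Ea -Eb Mb orbF andbT.
      by rewrite -[RHS]/(j == k') eq_sym.
    by rewrite andbF M'o ?Ea ?Eb // -[Top _ == Top _]/(_ == _).
  + by move=> p; rewrite inE => /orP[/eqP->//|]; apply: Htm.
- exists M'; split=> //=.
  + move=> w lw; rewrite /upd; case: eqVneq => [->|wv].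
      by rewrite -Eb M'b.
    by rewrite mM // M'o // ?Ea ?Eb // Mid_eq.
  + by move=> k k' km; apply: tM => // i1 i2 []; rewrite Eb.
- exists M'; split=> //=.
  + move=> w lw; rewrite /upd; case: eqVneq => [->|wv].
      by rewrite -Ea M'a.
    by rewrite mM // M'o // ?Ea ?Eb // Mid_eq.
  + by move=> k k' km; apply: tM => // i1 i2 []; rewrite Ea.
- exists M'; split=> //=.
  + move=> w lw; rewrite /upd; case: eqVneq => [->|wv].
      by rewrite -Eb M'b.
    case: eqVneq => [->|wu]; first by rewrite -Ea M'a.
    by rewrite mM // M'o // ?Ea ?Eb // Mid_eq.
  + by move=> k k' km; apply: tM => // i1 i2 []; rewrite Ea.
Qed.

Lemma planar_sweep m s w k M : wf_count (size (sw_cur s)) w = Some k ->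
  planar m s M ->
  exists M', planar m (foldl sweep_step s w) M' /\ size (sw_cur (foldl sweep_step s w)) = k.
Proof.
elim: w s M => [|[i o|i|i] w IHw] s M /=; first by case=> <- ?; exists M.
- by case: ifP => // _ hw H; apply: (IHw _ M); case: s hw H.
- case: ifP => // im hw /(planar_cup i)[M']; apply: IHw.
  case: s im hw => cur mate f tops circ /= im.
  by rewrite size_cat /= !addnS -size_cat cat_take_drop.
- case: ifP => // im hw /(planar_cap im)[M']; apply: IHw.
  rewrite -{}hw; congr wf_count; case: s im => cur mate f tops circ /= im.
  have E : size (take i cur ++ drop i.+2 cur) = (size cur).-2.
    by rewrite size_cat size_take size_drop (ltn_trans _ im) //; lia.
  by case: ifP => _ //; case: (mate _) => ?; case: (mate _) => ?.
Qed.

(** * The pairing of top and bottom points of the rectangle *)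

Definition pcolour (rho : pred nat) (x : bool * nat) :=
  x.1 (+) odd (count rho (iota 0 x.2)).

(** [rho] selects positions, the same on both edges, because closing up identifies bottom point [k]
    with top point [k]. The invariant selections are thus the unions of components of the
    closure. *)
Record planar_pairing (m : nat) (P : bool * nat -> bool * nat) : Prop := PlanarPairing {
  pp_dom : forall x, (x.2 < m)%N -> ((P x).2 < m)%N;
  pp_invol : forall x, (x.2 < m)%N -> P (P x) = x;
  pp_colour : forall rho : pred nat,
    (forall x, (x.2 < m)%N -> rho (P x).2 = rho x.2) ->
    forall x, (x.2 < m)%N -> rho x.2 -> pcolour rho (P x) = ~~ pcolour rho x }.

Definition boundary (s : sweep) (x : bool * nat) :=
  if x.1 then Mid (nth 0%N (sw_cur s) x.2) else Top x.2.

Lemma live_boundary m s x : size (sw_cur s) = m -> (x.2 < m)%N ->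
  live m (sw_cur s) (boundary s x).
Proof. by case: x => [[] k] /= <- // km; apply: mem_nth. Qed.

(** For a top point [partner] searches the list of top arcs and then the current points; the
    involution [M] guarantees that one of the searches succeeds and finds the right end. *)
Lemma boundary_partner m s M x : planar m s M -> size (sw_cur s) = m -> (x.2 < m)%N ->
  ((partner m s x).2 < m)%N /\ boundary s (partner m s x) = M (boundary s x).
Proof.
move=> H sm xm; have lx := live_boundary sm xm.
have lMx := pl_live H lx.
case: x xm lx lMx => [[] k] /= km lx lMx.
  rewrite (pl_mate H) ?mem_nth ?sm //.
  move: lMx; rewrite /boundary /=; case: (M _) => [j|v] //= vm.
  by rewrite -sm index_mem vm nth_index.
rewrite /boundary /= in lx lMx *.
case E : [seq p <- sw_tops s | _] => [|p t].
  have /hasPn nt : ~~ has (fun p => (p.1 == k) || (p.2 == k)) (sw_tops s).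
    by rewrite has_filter E.
  case EM : (M (Top k)) lMx => [j|v] /= lv.
    by have := pl_tops H j km; rewrite EM eqxx => /orP[] /nt; rewrite /= eqxx ?orbT.
  have mv : sw_mate s v = Top k by rewrite (pl_mate H) // -EM (pl_invol H).
  have hasv : has (fun u => endp_eqb (sw_mate s u) (Top k)) (sw_cur s).
    by apply/hasP; exists v => //; rewrite mv /=.
  rewrite -sm -has_find hasv; split=> //; congr Mid.
  have /endp_eqP := nth_find 0%N hasv; set u := nth _ _ _ => mu.
  have lu : u \in sw_cur s by rewrite mem_nth // -has_find.
  have : M (Mid u) = M (Mid v) by rewrite -!(pl_mate H) // mu.
  by move=> /(congr1 M); rewrite !(pl_invol H) // => -[].
have : p \in [seq p <- sw_tops s | (p.1 == k) || (p.2 == k)] by rewrite E inE eqxx.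
rewrite mem_filter => /andP[pk pt].
pose j := if p.1 == k then p.2 else p.1.
have hj : ((k, j) \in sw_tops s) || ((j, k) \in sw_tops s).
  rewrite /j; case: eqP pk => [<- _|_ /= /eqP <-]; rewrite -surjective_pairing pt ?orbT //.
have := pl_tops H j km; rewrite hj -/j => /esym/eqP E'; rewrite E'; split=> //.
by have := lMx; rewrite E'.
Qed.

Lemma boundary_inj m s x y : uniq (sw_cur s) -> size (sw_cur s) = m ->
  (x.2 < m)%N -> (y.2 < m)%N -> boundary s x = boundary s y -> x = y.
Proof.
case: x y => [[] k] [[] j] // u <- /= km jm []; last by move=> ->.
by move=> /eqP; rewrite nth_uniq // => /eqP ->.
Qed.

Lemma planar_partner m s M : planar m s M -> size (sw_cur s) = m ->
  planar_pairing m (partner m s).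
Proof.
move=> H sm; have Hu := pl_uniq H; split.
- by move=> x xm; case: (boundary_partner H sm xm).
- move=> x xm; have [h1 e1] := boundary_partner H sm xm.
  have [h2 e2] := boundary_partner H sm h1.
  by apply: (boundary_inj Hu sm) => //; rewrite e2 e1 (pl_invol H) // live_boundary.
move=> rho rhoP.
pose chi z := match z with Top j => rho j | Mid v => rho (index v (sw_cur s)) end.
have ci k : (k < m)%N -> index (nth 0%N (sw_cur s) k) (sw_cur s) = k.
  by move=> km; rewrite index_uniq // sm.
have chib x : (x.2 < m)%N -> chi (boundary s x) = rho x.2.
  by case: x => [[] k] //= km; rewrite ci.
have col x : (x.2 < m)%N -> colour chi (sw_cur s) (boundary s x) = pcolour rho x.
  case: x => [[] k] //= km; rewrite /pcolour addTb; congr (~~ odd _).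
  rewrite /before ci // -{1}(mkseq_nth 0%N (sw_cur s)) /mkseq -map_take take_iota sm.
  rewrite (minn_idPl (ltnW km)) count_map; apply: eq_in_count => j.
  by rewrite mem_iota /= => jk; rewrite ci // (ltn_trans jk).
move=> x xm rx; have [h1 e1] := boundary_partner H sm xm.
rewrite -!col // e1; apply: (pl_colour H); rewrite ?chib ?live_boundary //.
move=> z lz; have [y ym ->] : exists2 y, (y.2 < m)%N & z = boundary s y.
  case: z lz => [j|v] /= h; first by exists (false, j).
  by exists (true, index v (sw_cur s)); rewrite /= -?sm ?index_mem // /boundary /= nth_index.
by have [h2 e2] := boundary_partner H sm ym; rewrite -e2 !chib ?rhoP.
Qed.

(** * Components of the annular closure *)

(* The half point reached after an arc of the rectangle and a closure arc. *)
Definition advance (P : bool * nat -> bool * nat) (x : bool * nat) :=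
  (~~ (P x).1, (P x).2).

(** Contribution to the winding number of the closure arc just followed, read off from the edge of
    arrival: top counts $+1$, bottom $-1$. *)
Definition turn (x : bool * nat) : int := (-1) ^+ x.1.

Lemma trace_traject m s j0 n fuel here vis w :
  let f := advance (partner m s) in (n < fuel)%N ->
  (forall i, (i < n)%N -> iter i.+1 f here != (false, j0)) ->
  iter n.+1 f here = (false, j0) ->
  trace m s j0 fuel here vis w =
    (rev (map snd (traject f (f here) n.+1)) ++ vis,
     w + \sum_(x <- traject f (f here) n.+1) turn x).
Proof.
move=> f; elim: n fuel here vis w => [|n IHn] [|fuel] here vis w // nf hne heq.
  move: heq; rewrite /= /f big_seq1 /advance /turn.
  by case: (partner m s here) => [[] k] /= [] // <-; rewrite eqxx.
rewrite [LHS]/=; have E : partner m s here = (~~ (f here).1, (f here).2).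
  by rewrite /f /advance /= negbK -surjective_pairing.
have ne := hne 0%N isT; rewrite /= in ne.
rewrite E negbK -surjective_pairing (negPf ne) {}IHn //.
- set t := traject f (f (f here)) n.+1.
  rewrite -[traject f (f here) n.+2]/(f here :: t) map_cons rev_cons cat_rcons [in RHS]big_cons addrA.
  by move: t => t; rewrite [in RHS]/turn; case: (f here) => [[] k] /=.
- by move=> i ni; rewrite -iterSr hne.
- by rewrite -iterSr.
Qed.

Lemma advance_inj m P x y : planar_pairing m P -> (x.2 < m)%N -> (y.2 < m)%N ->
  advance P x = advance P y -> x = y.
Proof.
move=> H xm ym [/negb_inj e1 e2].
by rewrite -(pp_invol H xm) -(pp_invol H ym) [P x]surjective_pairing e1 e2 -surjective_pairing.
Qed.

Lemma iter_advance_dom m P x i : planar_pairing m P -> (x.2 < m)%N ->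
  ((iter i (advance P) x).2 < m)%N.
Proof. by move=> H xm; elim: i => //= i IH; apply: (pp_dom H). Qed.

(** [advance] is injective on the $2m$ half points, so every orbit is purely periodic. The bound
    keeps the period within the fuel [(4 * m).+2] of [trace]. *)
Lemma return_time m P x : planar_pairing m P -> (x.2 < m)%N ->
  exists n, [/\ (n < 2 * m)%N, iter n.+1 (advance P) x = x &
    forall i, (i < n)%N -> iter i.+1 (advance P) x != x].
Proof.
move=> H xm; set f := advance P.
have dom i := iter_advance_dom i H xm.
have cancel i d : iter (i + d) f x = iter i f x -> iter d f x = x.
  elim: i => //= i IH E; apply: IH.
  by apply: (advance_inj H) E; apply: dom.
have ex : exists n, (n < 2 * m)%N && (iter n.+1 f x == x).
  have : looping f x (2 * m).
    rewrite -[looping _ _ _]negbK -looping_uniq; apply/negP => /uniq_leq_size.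
    move=> /(_ [seq (b, k) | b <- [:: true; false], k <- iota 0 m]) hs.
    suff : ((2 * m).+1 <= 2 * m)%N by rewrite ltnn.
    have := hs _; rewrite size_traject size_allpairs size_iota; apply.
    move=> y /trajectP[i _ ->]; have := dom i; case: (iter i f x) => b k; rewrite -[(b, k).2]/k => km.
    by apply/allpairsP; exists (b, k); rewrite !inE mem_iota /= km; case: (b).
  move=> /trajectP[i im E]; exists (2 * m - i).-1; apply/andP; split; first lia.
  by apply/eqP; rewrite prednK ?subn_gt0 //; apply: (cancel i); rewrite subnKC // ltnW.
case: (ex_minnP ex) => n /andP[nm /eqP En] nmin; exists n; split=> // i ni.
apply/negP => E; have := nmin i; rewrite E (ltn_trans ni nm) => /(_ isT).
by rewrite leqNgt ni.
Qed.

(** Up to sign this is the winding number of a component whose passages alternate in direction along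
    the ray. *)
Lemma alternating_sum (rho : pred nat) m :
  \sum_(k <- iota 0 m | rho k) (-1) ^+ count rho (iota 0 k) =
  (odd (count rho (iota 0 m)))%:R :> int.
Proof.
elim: m => [|m IHm]; first by rewrite big_nil.
rewrite -addn1 iotaD big_cat IHm count_cat big_cons big_nil /= add0n.
case: (rho m); rewrite ?addn0 ?addr0 // oddD -signr_odd addbT.
by case: odd.
Qed.

(** [comp_min] expresses connectedness: an invariant set of positions contains all of [C] or nothing
    of it. [comp_gt1] says that only a straight strand can form a component with a single
    position. *)
Record component (m : nat) (P : bool * nat -> bool * nat) (j0 : nat) (C : seq nat) : Prop :=
 Component {
  comp_uniq : uniq C;
  comp_base : j0 \in C;
  comp_dom : forall k, k \in C -> (k < m)%N;
  comp_closed : forall x, (x.2 < m)%N -> ((P x).2 \in C) = (x.2 \in C);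
  comp_min : forall rho : pred nat, (forall x, (x.2 < m)%N -> rho (P x).2 = rho x.2) ->
     forall k, k \in C -> rho k = rho j0;
  comp_gt1 : P (false, j0) != (true, j0) -> (1 < size C)%N }.

(* By [pp_colour] with [rho] the set of points of the component, a component
   passes its points, ordered along a ray, in alternating directions. *)
Lemma component_orbit m P j0 : planar_pairing m P -> (j0 < m)%N ->
  exists n, let O := traject (advance P) (advance P (false, j0)) n.+1 in
    [/\ (n < 2 * m)%N, iter n.+1 (advance P) (false, j0) = (false, j0),
     forall i, (i < n)%N -> iter i.+1 (advance P) (false, j0) != (false, j0),
     component m P j0 (map snd O) &
     (\sum_(x <- O) turn x == 0) = ~~ odd (size O)].
Proof.
move=> H j0m; set f := advance P.
have x0m : ((false, j0).2 < m)%N by [].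
have [n [nm En nmin]] := return_time H x0m.
set x0 := (false, j0) in x0m En nmin; set O := traject f (f x0) n.+1.
have dom i := iter_advance_dom i H x0m.
have OP y : reflect (exists2 i, (i <= n)%N & y = iter i.+1 f x0) (y \in O).
  apply: (iffP trajectP) => -[i ni ->]; exists i => //; by rewrite iterSr.
have Of y : y \in O -> f y \in O.
  case/OP => i; rewrite leq_eqVlt => /orP[/eqP->|ni ->].
    by rewrite En => ->; apply/OP; exists 0%N.
  by apply/OP; exists i.+1.
have Ox0 : x0 \in O by apply/OP; exists n.
have Om y : y \in O -> (y.2 < m)%N by case/OP => i _ ->; apply: (dom i.+1).
have Og y : y \in O -> exists2 z, z \in O & y = f z.
  case/OP => -[|i] ni ->; first by exists x0.
  by exists (iter i.+1 f x0) => //; apply/OP; exists i => //; apply: ltnW.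
have uO : uniq O.
  suff : uniq (x0 :: traject f (f x0) n).
    rewrite /O trajectSr -iterSr En cons_uniq rcons_uniq //.
  rewrite -trajectS looping_uniq; apply/negP => /trajectP[i ni E].
  have d : forall j k, iter (j + k) f x0 = iter j f x0 -> iter k f x0 = x0.
    elim=> //= j IH k E'; apply: IH.
    by apply: (advance_inj H) E'; apply: dom.
  have : iter (n - i) f x0 = x0 by apply: (d i); rewrite subnKC // ltnW.
  have := nmin (n - i).-1; rewrite prednK ?subn_gt0 // => h /eqP.
  by apply/negP/h; lia.
set C := map snd O; pose rho := [pred k | k \in C].
have closed x : (x.2 < m)%N -> ((P x).2 \in C) = (x.2 \in C).
  have half y : (y.2 < m)%N -> y.2 \in C -> (P y).2 \in C.
    case: y => b k /= km /mapP[[b' k'] yO /= ek]; rewrite -{}ek in yO.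
    have [<-|nb] := eqVneq b' b; first by apply/mapP; exists (f (b', k)); first exact: Of.
    (* The orbit contains the opposite half of position [k]; hence the arc at [(b, k)] is the one by
       which the orbit arrived there, traversed backwards. *)
    have [[c l] zO ez] := Og _ yO; have zm := Om _ zO.
    have -> : P (b, k) = (c, l).
      rewrite -(pp_invol H zm); congr P; rewrite [P _]surjective_pairing.
      case: ez => e1 <-; rewrite -[(P _).1]negbK -e1.
      by case: (b') (b) nb => [] [].
    by apply/mapP; exists (c, l).
  move=> xm; apply/idP/idP; last exact: half.
  by move=> /(half _ (pp_dom H xm)); rewrite (pp_invol H).
(* An arc flips [pcolour] and so does the change of edge, so [pcolour] is constant on the orbit. The
   direction of a passage is therefore a function of the position, and no position is met twice. *)
have col y : y \in O -> y.1 = odd (count rho (iota 0 y.2)) (+) odd (count rho (iota 0 j0)).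
  case/OP => i ni ->; suff : pcolour rho (iter i.+1 f x0) = pcolour rho x0.
    by rewrite /pcolour addFb => <-; rewrite addbC -addbA addbb addbF.
  elim: i.+1 => // {}i {ni}IH; rewrite iterS -IH.
  have yO : iter i f x0 \in O by elim: (i) => // k hk; apply: Of.
  have yC : (iter i f x0).2 \in C by apply: map_f.
  have fc z : pcolour rho (f z) = ~~ pcolour rho (P z) by rewrite /pcolour -addNb.
  by rewrite fc (pp_colour H closed (dom i) yC) negbK.
have uC : uniq C.
  rewrite map_inj_in_uniq // => y z yO zO E.
  by rewrite [y]surjective_pairing [z]surjective_pairing (col _ yO) (col _ zO) E.
have Cm k : k \in C -> (k < m)%N by case/mapP => y /Om ym ->.
have pC : perm_eq C [seq k <- iota 0 m | rho k].
  apply: uniq_perm => //; first by rewrite filter_uniq ?iota_uniq.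
  move=> k; rewrite mem_filter mem_iota /= andb_idr //; exact: Cm.
have base : j0 \in C by apply/mapP; exists x0.
exists n; split=> //.
- split=> //.
  + move=> r rP k /mapP[y /OP[i _ ->] ->].
    rewrite -[j0]/(x0.2); elim: i.+1 => // {}i IH.
    by rewrite iterS -IH -(rP _ (dom i)).
  + move=> Pne; rewrite ltnNge; apply/negP => sC.
    have : size O = 1%N.
      by apply/eqP; rewrite -(size_map snd) eqn_leq sC lt0n size_eq0; case: (C) base.
    rewrite size_traject => -[n0]; move: En; rewrite n0 /= /f /advance => -[e1 e2].
    by case/negP: Pne; rewrite [P _]surjective_pairing e2 -[_.1]negbK e1.
- have -> : \sum_(x <- O) turn x =
    (-1) ^+ odd (count rho (iota 0 j0)) * \sum_(k <- C) (-1) ^+ count rho (iota 0 k).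
    rewrite big_map mulr_sumr; apply: eq_big_seq => y yO.
    by rewrite /turn col // signr_addb mulrC !signr_odd.
  rewrite mulf_eq0 signr_eq0 orFb (perm_big _ pC) big_filter alternating_sum.
  by rewrite -size_filter -(perm_size pC) size_map; case: (odd (size O)); rewrite ?oner_eq0 ?eqxx.
Qed.

Lemma component_trace m s j0 : planar_pairing m (partner m s) -> (j0 < m)%N ->
  exists2 C, component m (partner m s) j0 C &
    forall vis, exists vis' w,
      [/\ trace m s j0 (4 * m).+2 (false, j0) vis 0 = (vis', w),
          vis' =i C ++ vis & (w == 0) = ~~ odd (size C)].
Proof.
move=> H j0m; have [n [nm En nmin comp sum0]] := component_orbit H j0m.
exists [seq x.2 | x <- traject (advance (partner m s)) (advance (partner m s) (false, j0)) n.+1] => // vis.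
do 2!eexists; split; first by apply: trace_traject En; first lia.
- by move=> k; rewrite !mem_cat mem_rev.
- by rewrite add0r sum0 size_map.
Qed.

Lemma comps_cons m s j todo vis fuel : comps m s (j :: todo) vis fuel.+1 =
  if j \in vis then comps m s todo vis fuel else
  let: (vis', w) := trace m s j (4 * m).+2 (false, j) (j :: vis) 0 in
  let: (c, e) := comps m s todo vis' fuel in
  if w == 0 then (c.+1, e) else (c, e.+1).
Proof. by []. Qed.

(** A component with $|C|$ positions adds 1 to [e] if $|C|$ is odd and 0 otherwise. This is
    congruent to $|C|$ modulo 2, at most $|C|$, and equal to $|C|$ only for a single position, hence
    for a straight strand. Since [vis] is invariant, a new component is disjoint from it. *)
Lemma comps_count m s todo vis fuel :
  let P := partner m s in planar_pairing m P ->
  uniq todo -> (forall k, k \in todo -> (k < m)%N) ->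
  (forall x, (x.2 < m)%N -> ((P x).2 \in vis) = (x.2 \in vis)) ->
  (forall k, (k < m)%N -> k \notin vis -> k \in todo) ->
  (size todo <= fuel)%N ->
  let e := (comps m s todo vis fuel).2 in
  let n := count [predC vis] todo in
  [/\ odd e = odd n, (e <= n)%N &
    forall j, (j < m)%N -> j \notin vis -> P (false, j) != (true, j) -> (e < n)%N].
Proof.
move=> P H; elim: todo vis fuel => [|j todo IH] vis [|fuel] //.
- by move=> _ _ _ hc _; split=> // k km /(hc _ km).
- by move=> _ _ _ hc _; split=> // k km /(hc _ km).
move=> /andP[jt ut] hm hcl hcov sz.
rewrite comps_cons [count _ _]/=; case: ifPn => [jv|jv].
  rewrite add0n; apply: IH => //.
    by move=> k kt; apply: hm; rewrite inE kt orbT.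
  move=> k km kv; have := hcov k km kv; rewrite inE => /orP[/eqP E|//].
  by rewrite E jv in kv.
have jm : (j < m)%N by apply: hm; rewrite mem_head.
have [C comp tr] := component_trace H jm.
have [vis' [w [-> hvis' hw]]] := tr (j :: vis).
have inv' k : (k \in vis') = (k \in C) || (k \in vis).
  rewrite hvis' mem_cat inE; case: eqVneq => //= ->.
  by rewrite (comp_base comp).
have disj k : k \in C -> k \notin vis.
  move=> kC; have E : (k \in vis) = (j \in vis).
    exact: (comp_min comp (rho := [pred i | i \in vis]) hcl kC).
  by rewrite E.
have ut' : uniq (j :: todo) by rewrite /= jt.
have cC : count [pred k | k \in C] (j :: todo) = size C.
  rewrite -size_filter; apply/perm_size/uniq_perm; rewrite ?filter_uniq ?(comp_uniq comp) //.
  move=> k; rewrite mem_filter /= andb_idr // => kC.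
  by apply: hcov; [apply: (comp_dom comp)|apply: disj].
have cn : (~~ (j \in vis) + count [predC vis] todo = size C + count [predC vis'] todo)%N.
  rewrite -[LHS]/(count [predC vis] (j :: todo)) -cC.
  have -> : count [predC vis'] todo = count [predC vis'] (j :: todo).
    by rewrite /= inv' (comp_base comp).
  rewrite -count_predUI [X in (_ + X)%N](eq_count (a2 := pred0)) ?count_pred0 ?addn0.
    apply: eq_count => k /=; rewrite ?inE inv'.
    by case kC: (k \in C) => //=; rewrite disj.
  by move=> k /=; rewrite ?inE inv'; case: (k \in C).
rewrite jv in cn; rewrite cn.
have [] := IH vis' fuel ut => //.
- by move=> k kt; apply: hm; rewrite inE kt orbT.
- by move=> x xm; rewrite !inv' (comp_closed comp) // hcl.
- move=> k km; rewrite inv' negb_or => /andP[kC kv].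
  have := hcov k km kv; rewrite inE => /orP[/eqP E|//].
  by rewrite E (comp_base comp) in kC.
case: (comps m s todo vis' fuel) => c e /= oe en bad.
have C0 : (0 < size C)%N by case: (C) (comp_base comp).
have -> : (if w == 0 then (c.+1, e) else (c, e.+1)).2 = (odd (size C) + e)%N.
  by rewrite hw; case: odd.
split.
- by rewrite !oddD oddb oe.
- by apply: leq_add => //; case: odd.
move=> k km kv Pk; have [kC|kC] := boolP (k \in C); last first.
  rewrite -addnS; apply: leq_add; first by case: odd.
  by apply: bad Pk; rewrite // inv' negb_or kC.
suff : (1 < size C)%N by case: odd; lia.
have [E|kj] := eqVneq k j; first by apply: (comp_gt1 comp); rewrite -E.
rewrite ltnNge; apply/negP => C1; move: (comp_base comp) kC kj.
by case: (C) C1 => [|a [|//]] // _; rewrite !inE => /eqP <- /eqP ->; rewrite eqxx.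
Qed.

Lemma comps_through m s todo vis fuel :
  (forall j, (j < m)%N -> partner m s (false, j) = (true, j)) ->
  uniq todo -> (forall k, k \in todo -> (k < m)%N && (k \notin vis)) ->
  (size todo <= fuel)%N -> comps m s todo vis fuel = (0%N, size todo).
Proof.
move=> H; elim: todo vis fuel => [|j todo IH] vis [|fuel] // /andP[jt ut] hm sz.
have /andP[jm jv] := hm j (mem_head _ _).
rewrite comps_cons (negPf jv).
have a1 : advance (partner m s) (false, j) = (false, j) by rewrite /advance H.
have -> : trace m s j (4 * m).+2 (false, j) (j :: vis) 0 = ([:: j, j & vis], 1).
  by rewrite (@trace_traject _ _ _ 0) // trajectS a1 big_seq1 add0r.
rewrite IH // => k kt; have /andP[-> kv] : (k < m)%N && (k \notin vis).
  by apply: hm; rewrite inE kt orbT.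
by rewrite !in_cons (negPf kv) orbF orbb; apply: contraNN jt => /eqP <-.
Qed.

Definition through (m : nat) (s : sweep) :=
  (sw_tops s == [::]) && all (fun j => sw_mate s (nth 0%N (sw_cur s) j) == Top j) (iota 0 m).

Lemma closure_count_parity m w : wf_count m w = Some m ->
  let: (c, e) := closure_count m w in
  [/\ odd e = odd m, (e <= m)%N & (0 < m)%N -> (0 < c + e)%N].
Proof.
have [M0 H0] := planar_init m => hw; rewrite /closure_count.
have hw' : wf_count (size (sw_cur (sweep_word m [::]))) w = Some m by rewrite size_iota.
have [M [HM sM]] := planar_sweep hw' H0.
rewrite -/(sweep_word m w) in HM sM.
have HP := planar_partner HM sM.
have := @comps_count m _ (iota 0 m) [::] m.+1 HP (iota_uniq 0 m).
case E : (comps _ _ _ _ _) => [c e] /= [].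
- by move=> k; rewrite mem_iota.
- by [].
- by move=> k km _; rewrite mem_iota.
- by rewrite size_iota.
have -> : count [predC [::]] (iota 0 m) = m.
  by rewrite (eq_count (a2 := predT)) // count_predT size_iota.
move=> oe em _; split=> // m0; rewrite addnAC ltn_addr //.
move: E; case: (m) m0 => // k _; rewrite comps_cons in_nil.
case: trace => vis' wd; case: comps => c' e'.
by case: ifP => _ [<- <-]; rewrite ?addnS.
Qed.

(** If the state is not through, some top point is not joined to the bottom point at its own
    position, and the strict inequality of [comps_count] applies. *)
Lemma closure_count_through m w : wf_count m w = Some m ->
  let s := sweep_word m w in
  if through m s then closure_count m w = (sw_circ s, m)
  else ((closure_count m w).2 < m)%N.
Proof.
have [M0 H0] := planar_init m => hw s; rewrite /closure_count -/s.
have hw' : wf_count (size (sw_cur (sweep_word m [::]))) w = Some m by rewrite size_iota.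
have [M [HM sM]] := planar_sweep hw' H0.
rewrite -/(sweep_word m w) -/s in HM sM.
have HP := planar_partner HM sM.
have Pt j : (j < m)%N -> sw_mate s (nth 0%N (sw_cur s) j) = Top j ->
    partner m s (false, j) = (true, j).
  move=> jm mj; suff <- : partner m s (true, j) = (false, j) by apply: (pp_invol HP).
  by rewrite /= mj.
case: ifPn => [/andP[_ /allP h]|].
  rewrite comps_through ?size_iota ?iota_uniq //.
    by move=> j jm; apply: Pt => //; apply/eqP/h; rewrite mem_iota.
  by move=> k; rewrite mem_iota /= => ->.
have := @comps_count m s (iota 0 m) [::] m.+1 HP (iota_uniq 0 m).
case: (comps _ _ _ _ _) => c e [].
- by move=> k; rewrite mem_iota.
- by [].
- by move=> k km _; rewrite mem_iota.
- by rewrite size_iota.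
have -> : count [predC [::]] (iota 0 m) = m.
  by rewrite (eq_count (a2 := predT)) // count_predT size_iota.
move=> _ _ bad; rewrite negb_and => /orP[].
  case E : (sw_tops s) => [//|[j j'] t] _.
  have pt : (j, j') \in sw_tops s by rewrite E mem_head.
  have jm : (j < m)%N := pl_topsm HM pt.
  have [_] := boundary_partner HM sM (x := (false, j)) jm.
  rewrite -[boundary s (false, j)]/(Top j).
  have := pl_tops HM j' jm; rewrite pt => /esym/eqP -> => bd.
  by apply: (bad j jm) => //; apply/eqP => bE; rewrite bE in bd.
case/allPn => j; rewrite mem_iota /= => jm nj.
apply: (bad j jm) => //; apply: contra_neq nj => Pj.
have := pp_invol HP (x := (false, j)) jm; rewrite Pj /=.
by case: (sw_mate _ _) => // j' [->].
Qed.

(** * Shape of the bracket *)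

Definition slice_eqb (x y : slice) : bool :=
  match x, y with
  | Cross i o, Cross j q => (i == j) && (o == q)
  | Cup i, Cup j => i == j
  | Cap i, Cap j => i == j
  | _, _ => false
  end.

Lemma slice_eqP : Equality.axiom slice_eqb.
Proof.
case=> [i o|i|i] [j q|j|j] /=; apply: (iffP idP) => //.
- by case/andP=> /eqP-> /eqP->.
- by case=> -> ->; rewrite !eqxx.
- by move/eqP->.
- by case=> ->.
- by move/eqP->.
- by case=> ->.
Qed.

HB.instance Definition _ := hasDecEq.Build slice slice_eqP.

Lemma kstates_wf w m k x :
  x \in kstates w -> wf_count m w = Some k -> wf_count m x.2 = Some k.
Proof.
elim: w m x => [|[i o|i|i] w IH] m x /=.
- by rewrite inE => /eqP->.
- have E1 : (i.+1 < m)%N -> (i <= m.-2)%N && (m.-2.+2 == m) by lia.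
  move=> xw; case im: (i.+1 < m)%N => // h; have /andP[im' /eqP em] := E1 im.
  move: xw; rewrite mem_cat => /orP[] /mapP[y yw ->]; case: (o) => /=; rewrite ?im ?im' ?em;
    exact: IH h.
- by move=> /mapP[y yw ->]; case im: (_ <= _)%N => //= h; rewrite im; apply: IH h.
- by move=> /mapP[y yw ->]; case im: (_ <= _)%N => //= h; rewrite im; apply: IH h.
Qed.

(** * Coefficients in $\mathbb{Z}[A^{\pm1}]$ and admissible polynomials *)

Lemma Avar_neq0 : Avar != 0.
Proof. by rewrite tofrac_eq0 polyX_eq0. Qed.

Lemma laurent_tofrac p : laurent (tofrac p).
Proof. by exists p, 0%N; rewrite expr0 divr1. Qed.

Lemma laurentD x y : laurent x -> laurent y -> laurent (x + y).
Proof.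
move=> [p [k ->]] [q [l ->]]; exists (p * 'X^l + q * 'X^k), (k + l)%N.
by rewrite addf_div ?expf_neq0 ?Avar_neq0 // rmorphD !rmorphM !rmorphXn exprD.
Qed.

Lemma laurentM x y : laurent x -> laurent y -> laurent (x * y).
Proof.
move=> [p [k ->]] [q [l ->]]; exists (p * q), (k + l)%N.
by rewrite rmorphM exprD invfM mulrACA.
Qed.

Lemma laurent0 : laurent 0. Proof. by rewrite -tofrac0; exact: laurent_tofrac. Qed.
Lemma laurent1 : laurent 1. Proof. by rewrite -tofrac1; exact: laurent_tofrac. Qed.
Lemma laurentA : laurent Avar. Proof. exact: laurent_tofrac. Qed.
Lemma laurentAV : laurent Avar^-1.
Proof. by exists 1, 1%N; rewrite tofrac1 expr1 mul1r. Qed.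

Lemma laurentN x : laurent x -> laurent (- x).
Proof. by move=> [p [k ->]]; exists (- p), k; rewrite rmorphN mulNr. Qed.

Lemma laurentX x n : laurent x -> laurent (x ^+ n).
Proof.
by move=> lx; elim: n => [|n IH]; [exact: laurent1|rewrite exprS; exact: laurentM].
Qed.

Lemma laurent_sum (I : Type) (r : seq I) (P : pred I) (F : I -> KA) :
  (forall i, P i -> laurent (F i)) -> laurent (\sum_(i <- r | P i) F i).
Proof. by apply: big_ind; [exact: laurent0|exact: laurentD]. Qed.

Definition loop_value (F : fieldType) (a : F) : F := - a ^+ 2 - a^-1 ^+ 2.

Definition delta : KA := loop_value Avar.

Lemma laurent_delta : laurent delta.
Proof. by apply/laurentD/laurentN/laurentX/laurentAV/laurentN/laurentX/laurentA. Qed.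

Definition weight (x : nat * nat * seq slice) : KA := Avar ^+ x.1.1 * Avar^-1 ^+ x.1.2.

Lemma laurent_weight x : laurent (weight x).
Proof. by apply: laurentM; apply: laurentX; [exact: laurentA|exact: laurentAV]. Qed.

Lemma abracket_coef (R : comNzRingType) (a b : R) m w i :
  (abracket a%:P b%:P 'X m w)`_i =
  \sum_(x <- kstates w) let: (c, e) := closure_count m x.2 in
    a ^+ x.1.1 * b ^+ x.1.2 * (- a ^+ 2 - b ^+ 2) ^+ c * (e == i)%:R.
Proof.
rewrite /abracket coef_sum; apply: eq_bigr => x _.
case: (closure_count m x.2) => c e.
have -> : - a%:P ^+ 2 - b%:P ^+ 2 = (- a ^+ 2 - b ^+ 2)%:P.
  by rewrite -!polyC_exp -polyCN -polyCB.
by rewrite -!polyC_exp -!polyCM coefCM coefXn eq_sym.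
Qed.

Lemma skein_coef m w i : (skein m w)`_i =
  \sum_(x <- kstates w) let: (c, e) := closure_count m x.2 in
    weight x * delta ^+ c * (e == i)%:R.
Proof. exact: abracket_coef. Qed.

(* The constant term is a multiple of [delta] since a nonempty link has at
   least one component; this is what makes the unknot [t^0 = delta] suffice. *)
Definition admissible (n : nat) (p : {poly KA}) : Prop :=
  [/\ forall i, laurent p`_i,
      forall i, p`_i != 0 -> (i <= n)%N && (odd i == odd n) &
      exists2 c, laurent c & p`_0 = c * delta].

Lemma skein_admissible m w : (0 < m)%N -> wf_count m w = Some m ->
  admissible m (skein m w).
Proof.
move=> m0 hw.
have par x : x \in kstates w -> let: (c, e) := closure_count m x.2 in
    [/\ odd e = odd m, (e <= m)%N & (0 < c + e)%N].
  move=> /kstates_wf/(_ hw)/closure_count_parity.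
  by case: (closure_count m x.2) => c e [? ? /(_ m0)].
split.
- move=> i; rewrite skein_coef; apply: laurent_sum => x _.
  case: (closure_count m x.2) => c e; apply: laurentM.
    by apply: laurentM; [exact: laurent_weight|apply/laurentX/laurent_delta].
  by case: (_ == _); [exact: laurent1|exact: laurent0].
- move=> i; apply: contraR => nh; rewrite skein_coef big1_seq // => x /andP[_ /par].
  case: (closure_count m x.2) => c e [oe em _].
  case: eqP => [E|_]; last by rewrite mulr0.
  by rewrite -E em oe eqxx in nh.
(* A state without essential circles has $c>0$ and gives up one factor [delta]; in the other states
   the last factor is zero, so the truncation in [c.-1] is harmless. *)
exists (\sum_(x <- kstates w) let: (c, e) := closure_count m x.2 in
    weight x * delta ^+ c.-1 * (e == 0%N)%:R).
  apply: laurent_sum => x _.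
  case: (closure_count m x.2) => c e; apply: laurentM.
    by apply: laurentM; [exact: laurent_weight|apply/laurentX/laurent_delta].
  by case: (_ == _); [exact: laurent1|exact: laurent0].
rewrite skein_coef mulr_suml; apply: eq_big_seq => x /par.
case: (closure_count m x.2) => c [|e] [_ _]; last by rewrite !mulr0 mul0r.
by rewrite addn0; case: c => // c _; rewrite !mulr1 exprSr mulrA.
Qed.

(** * The leading coefficient *)

(** The coefficient of $z^m$ as a function of the sweep state reached so far, so that crossings can
    be smoothed one at a time while the state is followed. *)
Definition lead (m : nat) (s : sweep) (w : seq slice) : KA :=
  \sum_(x <- kstates w) weight x *
    let s' := foldl sweep_step s x.2 in
    if through m s' then delta ^+ sw_circ s' else 0.

Lemma skein_lead m w : wf_count m w = Some m ->
  (skein m w)`_m = lead m (sweep_word m [::]) w.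
Proof.
move=> hw; rewrite skein_coef; apply: eq_big_seq => x /kstates_wf/(_ hw) hx.
have := closure_count_through hx; rewrite -[foldl _ _ _]/(sweep_word m x.2) /=.
case: ifP => _; first by move=> ->; rewrite eqxx mulr1.
by case: (closure_count m x.2) => c e /= /ltn_eqF ->; rewrite !mulr0.
Qed.

Lemma lead_nil m s : lead m s [::] = if through m s then delta ^+ sw_circ s else 0.
Proof. by rewrite /lead big_seq1 /weight !expr0 !mul1r. Qed.

Lemma lead_cap m s i w : lead m s (Cap i :: w) = lead m (sweep_step s (Cap i)) w.
Proof. by rewrite /lead big_map. Qed.

Lemma lead_cup m s i w : lead m s (Cup i :: w) = lead m (sweep_step s (Cup i)) w.
Proof. by rewrite /lead big_map. Qed.

Lemma weightSl x a b w : weight (a.+1, b, x) = Avar * weight (a, b, w).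
Proof. by rewrite /weight exprS mulrA. Qed.

Lemma weightSr x a b w : weight (a, b.+1, x) = Avar^-1 * weight (a, b, w).
Proof. by rewrite /weight exprS mulrCA. Qed.

(** Kauffman's skein relation for leading coefficients. *)
Lemma lead_cross m s i o w : lead m s (Cross i o :: w) =
  (if o then Avar else Avar^-1) * lead m s [:: Cap i, Cup i & w] +
  (if o then Avar^-1 else Avar) * lead m s w.
Proof.
rewrite lead_cap lead_cup /lead big_cat !big_map !mulr_sumr.
case: o; last rewrite addrC; congr (_ + _); apply: eq_bigr => -[[a b] x] _;
  by rewrite (weightSl _ _ _ x) || rewrite (weightSr _ _ _ x); rewrite -mulrA.
Qed.

Lemma tops_step s sl : sw_tops s != [::] -> sw_tops (sweep_step s sl) != [::].
Proof.
case: s => cur mate f tops circ; case: sl => [i o|i|i] //= nt.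
by case: ifP => _ //; case: (mate _) => ?; case: (mate _) => ?.
Qed.

Lemma lead_dead m s w : sw_tops s != [::] -> lead m s w = 0.
Proof.
move=> nt; rewrite /lead big1 // => x _.
have : sw_tops (foldl sweep_step s x.2) != [::].
  by elim: x.2 s nt => //= sl t IH s /(tops_step sl)/IH.
by rewrite /through => /negPf->; rewrite mulr0.
Qed.

(** * One cup travelling among through strands *)

Record through_state (m c : nat) (s : sweep) : Prop := ThroughState {
  th_uniq : uniq (sw_cur s);
  th_fresh : forall v, v \in sw_cur s -> (v < sw_fresh s)%N;
  th_mate : map (sw_mate s) (sw_cur s) = map Top (iota 0 m);
  th_tops : sw_tops s = [::];
  th_circ : sw_circ s = c }.

Record cup_state (m p c : nat) (s : sweep) (l1 l2 : seq nat) (u v : nat) : Prop := CupState {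
  cu_cur : sw_cur s = l1 ++ [:: u; v] ++ l2;
  cu_size : size l1 = p;
  cu_uniq : uniq (sw_cur s);
  cu_fresh : forall z, z \in sw_cur s -> (z < sw_fresh s)%N;
  cu_mate : map (sw_mate s) (l1 ++ l2) = map Top (iota 0 m);
  cu_mateu : sw_mate s u = Mid v;
  cu_matev : sw_mate s v = Mid u;
  cu_tops : sw_tops s = [::];
  cu_circ : sw_circ s = c }.

Lemma through_state_init m : through_state m 0 (sweep_word m [::]).
Proof. by split=> //=; [exact: iota_uniq|move=> v; rewrite mem_iota]. Qed.

Lemma through_state_through m c s : through_state m c s -> through m s.
Proof.
move=> H; rewrite /through (th_tops H) eqxx /=; apply/allP => j; rewrite mem_iota /= => jm.
have sz : size (sw_cur s) = m.
  by rewrite -(size_map (sw_mate s)) (th_mate H) size_map size_iota.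
rewrite -(nth_map 0%N (Top 0)) ?sz // (th_mate H) (nth_map 0%N) ?size_iota //.
by rewrite nth_iota.
Qed.

Lemma through_cup m c s p : through_state m c s -> (p <= m)%N ->
  exists l1 l2 u v, cup_state m p c (sweep_step s (Cup p)) l1 l2 u v.
Proof.
case: s => cur mate f tops circ [/= Hu Hf Hm Ht Hc] pm.
have sz : size cur = m by rewrite -(size_map mate) Hm size_map size_iota.
have fc z : z \in cur -> (z != f) * (z != f.+1).
  by move=> /Hf zf; split; apply/eqP; lia.
exists (take p cur), (drop p cur), f, f.+1; split=> //=.
- by rewrite size_take sz; case: ltngtP pm.
- rewrite -[_ :: _]/([:: f; f.+1] ++ drop p cur) uniq_insert2 cat_take_drop Hu andbT.
  by apply/and3P; split; [lia|apply/negP => /Hf; lia|apply/negP => /Hf; lia].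
- move=> z; rewrite -[_ :: _]/([:: f; f.+1] ++ drop p cur) mem_cat !inE orbCA.
  rewrite [X in _ || X]orbCA -mem_cat cat_take_drop.
  by case/or3P=> [/eqP->|/eqP->|/Hf h]; lia.
- rewrite cat_take_drop -Hm; apply/eq_in_map => z /fc[z1 z2].
  by rewrite /upd (negPf z1) (negPf z2).
- by rewrite /upd !eqxx; case: eqP => //; lia.
- by rewrite /upd eqxx.
Qed.

(** Effect of a cap at [i] on a cup at [p]: in the same place it closes a circle; one place to
    either side the zigzag straightens into a through strand; elsewhere two through strands are
    joined and the leading term is lost. *)
Definition cap_value (F : fieldType) (a : F) (p i : nat) : F :=
  if p == i then loop_value a else if (p == i.+1) || (p.+1 == i) then 1 else 0.

Lemma mate_top m (mate : nat -> endp) l : map mate l = map Top (iota 0 m) ->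
  forall v, v \in l -> exists j, mate v = Top j.
Proof.
move=> E v vl; have : mate v \in map mate l by apply: map_f.
by rewrite E => /mapP[j _ ->]; exists j.
Qed.

Lemma lead_cap_dead m s i w j k :
  sw_mate s (nth 0%N (sw_cur s) i) = Top j ->
  sw_mate s (nth 0%N (sw_cur s) i.+1) = Top k ->
  lead m s (Cap i :: w) = 0.
Proof.
move=> e1 e2; rewrite lead_cap; apply: lead_dead.
by case: s e1 e2 => cur mate f tops circ /= -> ->.
Qed.

Lemma lead_through_cap m c s i w : through_state m c s -> (i.+1 < m)%N ->
  lead m s (Cap i :: w) = 0.
Proof.
move=> H im; have sz : size (sw_cur s) = m.
  by rewrite -(size_map (sw_mate s)) (th_mate H) size_map size_iota.
have T k : (k < m)%N -> exists j, sw_mate s (nth 0%N (sw_cur s) k) = Top j.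
  by move=> km; apply: (mate_top (th_mate H)); rewrite mem_nth ?sz.
have [j e1] := T _ (ltnW im); have [k e2] := T _ im.
exact: lead_cap_dead e1 e2.
Qed.

Lemma map_upd (mate : nat -> endp) v x l : v \notin l -> map (upd mate v x) l = map mate l.
Proof.
by move=> vl; apply/eq_in_map => z zl; rewrite /upd; case: eqP vl zl => // -> /negPf->.
Qed.

Lemma lead_cup_cap m p c s l1 l2 u v i w V :
  cup_state m p c s l1 l2 u v -> (p <= m)%N -> (i <= m)%N ->
  (forall c s, through_state m c s -> lead m s w = delta ^+ c * V) ->
  lead m s (Cap i :: w) = delta ^+ c * (cap_value Avar p i * V).
Proof.
move=> H pm im HV; rewrite /cap_value.
have szm : (size l1 + size l2 = m)%N.
  by rewrite -size_cat -(size_map (sw_mate s)) (cu_mate H) size_map size_iota.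
have topl := mate_top (cu_mate H).
case: H topl => Ec <- Hu Hf Hm Hmu Hmv Ht Hc topl.
have /and4P[uv ul vl ull] : [&& u != v, u \notin l1 ++ l2, v \notin l1 ++ l2 & uniq (l1 ++ l2)].
  by rewrite -uniq_insert2 -Ec.
have sub l : subseq l (sw_cur s) ->
    uniq l /\ forall z, z \in l -> (z < sw_fresh s)%N.
  by move=> sl; split; [apply: subseq_uniq Hu|move=> z /(mem_subseq sl)/Hf].
case: (eqVneq (size l1) i) => [ei|ni].
  rewrite lead_cap (HV c.+1) ?exprSr ?mulrA //.
  have [] := sub (l1 ++ l2).
    by rewrite Ec cat_subseq // (suffix_subseq [:: u; v]).
  case: s Ec {sub Hu Hf} Hm Hmu Hmv Ht Hc {topl} => cur mate f tops circ /= Ec Hm Hmu Hmv -> -> Hu Hf.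
  have -> : nth 0%N cur i = u by rewrite Ec nth_cat -ei ltnn subnn.
  have -> : nth 0%N cur i.+1 = v by rewrite Ec nth_cat -ei ltnNge leqnSn subSnn.
  have -> : take i cur ++ drop i.+2 cur = l1 ++ l2.
    rewrite Ec take_size_cat // -[[:: u, v & _]]/([:: u; v] ++ l2) catA.
    by rewrite drop_size_cat // size_cat ei addn2.
  by rewrite Hmu /= eqxx.
case: (eqVneq (size l1) i.+1) => [ei|ni1] /=.
  rewrite lead_cap mul1r; apply: HV.
  case/lastP: l1 ei Ec Hm topl ul vl ull {szm pm ni} => // l1 a; rewrite size_rcons => -[ei].
  rewrite !cat_rcons /= => Ec Hm topl ul vl ull.
  have [] := sub (l1 ++ v :: l2).
    by rewrite Ec cat_subseq // (suffix_subseq [:: a; u]).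
  case: s Ec {sub Hu Hf} Hm Hmu Hmv Ht Hc topl => cur mate f tops circ /= Ec Hm Hmu Hmv -> -> topl Hu Hf.
  have -> : nth 0%N cur i = a by rewrite Ec nth_cat -ei ltnn subnn.
  have -> : nth 0%N cur i.+1 = u by rewrite Ec nth_cat -ei ltnNge leqnSn subSnn.
  have -> : take i cur ++ drop i.+2 cur = l1 ++ v :: l2.
    rewrite Ec take_size_cat // -[[:: a, u & _]]/([:: a; u] ++ v :: l2) catA.
    by rewrite drop_size_cat // size_cat ei addn2.
  have [j ma] : exists j, mate a = Top j by apply: topl; rewrite mem_cat mem_head orbT.
  rewrite ma Hmu /=; split=> //=.
  move: vl; rewrite mem_cat inE !negb_or => /and3P[v1 _ v2].
  by rewrite map_cat /= !map_upd // /upd eqxx -Hm map_cat /= ma.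
case: (eqVneq (size l1).+1 i) => [ei|ni2] /=.
  rewrite lead_cap mul1r; apply: HV.
  case: l2 Ec szm Hm topl ul vl ull => [|b l2] Ec szm Hm topl ul vl ull.
    by move: szm im; rewrite -ei addn0 => ->; rewrite ltnn.
  have [] := sub (l1 ++ u :: l2).
    rewrite Ec cat_subseq //.
    exact: (cat_subseq (subseq_refl [:: u]) (suffix_subseq [:: v; b] l2)).
  case: s Ec {sub Hu Hf} Hm Hmu Hmv Ht Hc topl => cur mate f tops circ /= Ec Hm Hmu Hmv -> -> topl Hu Hf.
  have -> : nth 0%N cur i = v by rewrite Ec nth_cat -ei ltnNge leqnSn subSnn.
  have -> : nth 0%N cur i.+1 = b.
    by rewrite Ec nth_cat -ei ltnNge (leq_trans (leqnSn _)) // -addn2 addKn.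
  have -> : take i cur ++ drop i.+2 cur = l1 ++ u :: l2.
    rewrite Ec -cat_rcons take_size_cat ?size_rcons //.
    rewrite -[[:: v, b & _]]/([:: v; b] ++ l2) catA drop_size_cat.
      by rewrite cat_rcons.
    by rewrite size_cat size_rcons ei addn2.
  have [j ma] : exists j, mate b = Top j by apply: topl; rewrite mem_cat mem_head orbT.
  have nub : (u == b) = false.
    by move: ul; rewrite mem_cat inE !negb_or => /and3P[_ /negPf].
  rewrite Hmv ma /= nub; split=> //=.
  move: ul; rewrite mem_cat inE !negb_or => /and3P[u1 _ u2].
  by rewrite map_cat /= !map_upd // /upd eqxx -Hm map_cat /= ma.
rewrite !mul0r mulr0.
have T k : (k <= m.+1)%N -> k != size l1 -> k != (size l1).+1 ->
    exists j, sw_mate s (nth 0%N (sw_cur s) k) = Top j.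
  move=> km k1 k2; apply: topl; rewrite Ec nth_cat mem_cat.
  case: ltnP => h; first by rewrite mem_nth.
  have h2 : (2 <= k - size l1)%N by lia.
  rewrite (nth_cat _ [:: u; v]) ltnNge h2 [X in _ || X]mem_nth ?orbT //=; lia.
have [j e1] : exists j, sw_mate s (nth 0%N (sw_cur s) i) = Top j by apply: T; lia.
have [k e2] : exists j, sw_mate s (nth 0%N (sw_cur s) i.+1) = Top j by apply: T; lia.
exact: lead_cap_dead e1 e2.
Qed.

(* The coefficient of the through diagram when the crossings [w] are resolved
   below a cup at position [p] and above [Cap m.-1]: smoothing a crossing at [j]
   moves an adjacent cup to [j], closes a circle if the cup is at [j], and
   otherwise destroys two through strands. *)
Fixpoint cup_eval (F : fieldType) (a : F) (m p : nat) (w : seq (nat * bool)) : F :=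
  match w with
  | [::] => cap_value a p m.-1
  | (j, o) :: w' => (if o then a else a^-1) * (cap_value a p j * cup_eval a m j w')
                    + (if o then a^-1 else a) * cup_eval a m p w'
  end.

(** The cap of a smoothing at [j] leaves only through strands, or nothing of leading degree, and the
    cup of that smoothing is the new one, at [j]. The position of the cup is thus all that has to be
    remembered. *)
Lemma lead_cup_eval m p c s l1 l2 u v w :
  cup_state m p c s l1 l2 u v -> (p <= m)%N -> all (fun q => q.1 <= m)%N w ->
  lead m s ([seq Cross q.1 q.2 | q <- w] ++ [:: Cap m.-1]) = delta ^+ c * cup_eval Avar m p w.
Proof.
elim: w p c s l1 l2 u v => [|[j o] w IH] p c s l1 l2 u v H pm.
  move=> _; rewrite (lead_cup_cap (V := 1) H) ?mulr1 ?leq_pred //.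
  by move=> c' s' H'; rewrite lead_nil (through_state_through H') (th_circ H') mulr1.
move=> /andP[jm wm]; rewrite lead_cross.
rewrite (lead_cup_cap (V := cup_eval Avar m j w) H) //; last first.
  move=> c' s' H'; rewrite lead_cup; have [? [? [? [? H'']]]] := through_cup H' jm.
  exact: IH H'' jm wm.
by rewrite (IH _ _ _ _ _ _ _ H) // mulrCA [X in _ + X]mulrCA -mulrDr.
Qed.

(** * Evaluation of the slide word *)

Lemma cap_value_far (F : fieldType) (a : F) p i :
  (p.+1 < i)%N || (i.+1 < p)%N -> cap_value a p i = 0.
Proof.
move=> pi; rewrite /cap_value; have -> : (p == i) = false by lia.
have -> : (p == i.+1) = false by lia.
by have -> : (p.+1 == i) = false by lia.
Qed.

(** Every crossing of the row is out of reach of the cup, so only the vertical smoothings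
    survive. *)
Lemma cup_eval_far (F : fieldType) (a : F) m p q n o w : (p.+1 < q)%N ->
  cup_eval a m p ([seq (i, o) | i <- iota q n] ++ w) =
  (if o then a^-1 else a) ^+ n * cup_eval a m p w.
Proof.
elim: n q => [|n IH] q pq /=; first by rewrite mul1r.
rewrite IH ?(ltn_trans pq) // cap_value_far ?pq //.
by rewrite mul0r mulr0 add0r exprS mulrA.
Qed.

Lemma cap_value_refl (F : fieldType) (a : F) p : cap_value a p p = loop_value a.
Proof. by rewrite /cap_value eqxx. Qed.

Lemma cap_valueS (F : fieldType) (a : F) p : cap_value a p.+1 p = 1.
Proof. by rewrite /cap_value gtn_eqF ?eqxx. Qed.

Lemma cap_valueP (F : fieldType) (a : F) p : cap_value a p p.+1 = 1.
Proof. by rewrite /cap_value ltn_eqF ?eqxx ?orbT. Qed.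

(** The last [r] crossings of the second row, followed by the final cap. The induction lengthens
    this suffix, from the outer edge inward. *)
Definition inward (F : fieldType) (a : F) (m r p : nat) : F :=
  cup_eval a m p [seq (i, true) | i <- iota (m - r) r].

Lemma inward_step (F : fieldType) (a : F) m r p : (r < m)%N ->
  inward a m r.+1 p = a * (cap_value a p (m - r).-1 * inward a m r (m - r).-1) + a^-1 * inward a m r p.
Proof.
move=> rm; rewrite /inward /=; have -> : (m - r.+1 = (m - r).-1)%N by lia.
by have -> : (m - r).-1.+1 = (m - r)%N by lia.
Qed.

(** The weights $a^{-2k}$ are those produced by [outward_value]. The first clause, for a cup just
    inside the first crossing, is what the next inductive step needs: it is the value after the
    cap-cup smoothing of the crossing to be added. For [r = 0] the crossing and the final cap form a
    kink, with factor $-a^3$. *)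
Lemma inward_value (F : fieldType) (a : F) m r : a != 0 -> (r < m)%N ->
  ((r.+1 < m)%N -> inward a m r.+1 (m - r.+2) = - a ^+ r.+3) /\
  \sum_(k < r.+2) a^-1 ^+ (2 * k) * inward a m r.+1 (m - r.+1 + k) = a ^+ r.+1.+4.
Proof.
move=> a0; elim: r => [|r IH] rm.
  have h1 p : inward a m 1 p = - a ^+ 3 * cap_value a p m.-1.
    rewrite inward_step // subn0 /inward /= !cap_value_refl /loop_value.
    by move: (cap_value a p m.-1) => x; field.
  split=> [m1|].
    have em : m.-1 = (m - 2).+1 by lia.
    by rewrite h1 em cap_valueP mulr1.
  rewrite !big_ord_recl big_ord0 /= !h1 subn1 addn0 addn1 cap_value_refl cap_valueS /loop_value.
  by field.
have [IH1 IH2] := IH (ltnW rm).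
have {}IH1 := IH1 rm; set j := (m - r.+2)%N in IH1 *.
have ej : (m - r.+1 = j.+1)%N by rewrite /j; lia.
have step p : inward a m r.+2 p = a * (cap_value a p j * - a ^+ r.+3) + a^-1 * inward a m r.+1 p.
  by rewrite inward_step // ej IH1.
split=> [r2m|].
  have -> : (m - r.+3 = j.-1)%N by rewrite /j; lia.
  have ej1 : j = j.-1.+1 by rewrite /j; lia.
  rewrite step {2}ej1 cap_valueP mul1r.
  (* This cup lies two places inside the first remaining crossing, out of reach of the row and of
     the final cap. *)
  have -> : inward a m r.+1 j.-1 = 0.
    rewrite /inward ej -[X in cup_eval _ _ _ X]cats0 cup_eval_far /=; last by lia.
    by rewrite cap_value_far ?mulr0 // /j; lia.
  by rewrite mulr0 addr0 mulrN -exprS.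
rewrite ej in IH2.
rewrite big_ord_recl big_ord_recl /= !step addn0 addn1 cap_value_refl cap_valueS.
(* From the third term on the new crossing at [j] is out of reach: $a^{-3}$ is $a^{-1}$ from its
   vertical smoothing times $a^{-2}$ from the index shift. *)
have -> : \sum_(i < r.+1) a^-1 ^+ (2 * bump 0 (bump 0 i)) * inward a m r.+2 (j + bump 0 (bump 0 i)) =
  a^-1 ^+ 3 * \sum_(i < r.+1) a^-1 ^+ (2 * bump 0 i) * inward a m r.+1 (j.+1 + bump 0 i).
  rewrite mulr_sumr; apply: eq_bigr => i _.
  rewrite /bump /= !add1n step cap_value_far; last by lia.
  rewrite mul0r mulr0 add0r addSnnS.
  have -> : (2 * i.+2 = (2 * i.+1).+2)%N by lia.
  rewrite !exprS expr0; ring.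
(* The induction hypothesis is solved for its tail; the value at [j.+1] that this brings in cancels
   against the one in the second term. *)
move: IH2; rewrite big_ord_recl /= addn0 mul1r => /(canRL (addKr _)) ->.
rewrite IH1 /loop_value !exprS expr0; move: (inward _ _ _ _) (a ^+ r) => x y.
by field.
Qed.

(** At each crossing the cup moves on with factor $a^{-1}$ or stays with factor $a$; once it stays,
    the rest of the row is out of reach. The index [k] counts the moves. *)
Lemma outward_value (F : fieldType) (a : F) m n p w :
  cup_eval a m p ([seq (i, false) | i <- iota p.+1 n] ++ w) =
  \sum_(k < n.+1) a ^+ (n - k) * a^-1 ^+ k * cup_eval a m (p + k) w.
Proof.
elim: n p => [|n IH] p; first by rewrite big_ord_recl big_ord0 /= !mul1r addn0 addr0.
rewrite /= (@cup_eval_far _ _ _ p) // IH cap_valueP mul1r [RHS]big_ord_recl /= subn0 mulr1 addn0 addrC.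
rewrite exprS mulrA; congr (_ + _); rewrite mulr_sumr; apply: eq_bigr => i _.
by rewrite /bump /= add1n subSS addSnnS !exprS; ring.
Qed.

(** Writing $a^{m-k}a^{-k}=a^m a^{-2k}$ turns the outward sum into that of [inward_value] at
    [r = m.-1], whose value is $a^{m+4}$. *)
Lemma slide_value (F : fieldType) (a : F) m : a != 0 -> (0 < m)%N ->
  cup_eval a m 0 ([seq (i, false) | i <- iota 1 m] ++ [seq (i, true) | i <- iota 0 m]) =
  a ^+ (2 * m + 4).
Proof.
move=> a0 m0; rewrite outward_value.
have [|_] := @inward_value F a m m.-1 a0; first by lia.
rewrite prednK // subnn => E.
transitivity (a ^+ m * a ^+ m.+4); last by rewrite -exprD; congr (_ ^+ _); lia.
rewrite -E mulr_sumr; apply: eq_bigr => k _.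
rewrite /inward subnn add0n mulrA; congr (_ * _).
have km : (k <= m)%N by rewrite -ltnS.
have -> : a ^+ m = a ^+ (m - k) * a ^+ k by rewrite -exprD subnK.
rewrite mul2n -addnn exprD -mulrA; congr (_ * _).
by rewrite mulrA -exprMn divff // expr1n mul1r.
Qed.

(** * Elimination *)

Lemma wf_crosses m o l w : all (fun i => i.+1 < m)%N l ->
  wf_count m ([seq Cross i o | i <- l] ++ w) = wf_count m w.
Proof. by elim: l => //= i l IH /andP[-> /IH]. Qed.

Lemma slide_wf m : (0 < m)%N -> wf_count m (slide m true) = Some m.
Proof.
move=> m0; rewrite /slide /= wf_crosses; last first.
  by apply/allP => i; rewrite mem_iota; lia.
rewrite wf_crosses; last by apply/allP => i; rewrite mem_iota; lia.
by rewrite /= ifT //; lia.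
Qed.

Lemma spiral_wf m : wf_count m (spiral m) = Some m.
Proof.
rewrite -[spiral m]cats0 /spiral wf_crosses //.
by apply/allP => i; rewrite mem_iota; lia.
Qed.

Lemma skein_nil_lead m : (skein m [::])`_m = 1.
Proof.
have H := through_state_init m.
by rewrite skein_lead // lead_nil (through_state_through H) (th_circ H).
Qed.

Lemma skein_slide_lead m : (0 < m)%N -> (skein m (slide m true))`_m = Avar ^+ (2 * m + 4).
Proof.
move=> m0; rewrite skein_lead ?slide_wf // -(slide_value Avar_neq0 m0) /slide lead_cup.
have [l1 [l2 [u [v H]]]] := through_cup (through_state_init m) (leq0n m).
rewrite -[RHS]mul1r -[X in X * _](expr0 delta) -(lead_cup_eval H) //; last first.
  by rewrite all_cat !all_map; apply/andP; split; apply/allP => i; rewrite mem_iota /=; lia.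
by rewrite map_cat -!map_comp -catA.
Qed.

Lemma lead_crosses m c s l : through_state m c s -> all (fun i => i.+1 < m)%N l ->
  lead m s [seq Cross i true | i <- l] = Avar^-1 ^+ size l * delta ^+ c.
Proof.
move=> H; elim: l => [_|i l IH /andP[im lm]].
  by rewrite lead_nil (through_state_through H) (th_circ H) mul1r.
by rewrite /= lead_cross (lead_through_cap _ H) // mulr0 add0r IH // exprS mulrA.
Qed.

(** Only the all-vertical state is through: each crossing gives $A^{-1}$, and the framing correction
    $-A^3$. *)
Lemma tclos_lead n : (0 < n)%N -> (tclos n)`_n = (- Avar ^+ 2) ^+ n.-1.
Proof.
case: n => // n _; rewrite /tclos coefZ skein_lead ?spiral_wf //.
rewrite (lead_crosses (through_state_init _)); last first.
  by apply/allP => i; rewrite mem_iota /=; lia.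
rewrite mulr1 size_iota /= -exprMn; congr (_ ^+ _).
by rewrite mulNr exprSr mulfK ?Avar_neq0.
Qed.

Lemma tclos0 : tclos 0 = delta%:P.
Proof.
apply/polyP => i; rewrite skein_coef big_seq1 coefC.
rewrite -[LHS]/(1 * 1 * delta ^+ 1 * (0%N == i)%:R) !mul1r expr1 eq_sym.
by case: eqP => _; rewrite ?mulr1 ?mulr0.
Qed.

Lemma admissibleZ n c p : laurent c -> admissible n p -> admissible n (c *: p).
Proof.
move=> lc [h1 h2 [d ld h3]]; split.
- by move=> i; rewrite coefZ; apply: laurentM.
- by move=> i; rewrite coefZ mulf_eq0 negb_or => /andP[_ /h2].
- by exists (c * d); [apply: laurentM|rewrite coefZ h3 mulrA].
Qed.

Lemma admissibleB n p q : admissible n p -> admissible n q -> admissible n (p - q).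
Proof.
move=> [h1 h2 [d ld h3]] [k1 k2 [e le k3]]; split.
- by move=> i; rewrite coefB; apply/laurentD/laurentN.
- move=> i; rewrite coefB; have [->|/h2 //] := eqVneq p`_i 0.
  by rewrite sub0r oppr_eq0; apply: k2.
- by exists (d - e); [apply/laurentD/laurentN|rewrite coefB h3 k3 mulrBl].
Qed.

(** Parity excludes the degree $n+1$, so losing the top term lowers the bound by two. *)
Lemma admissible_lower n p : admissible n.+2 p -> p`_n.+2 = 0 -> admissible n p.
Proof.
move=> [h1 h2 h3] p0; split=> // i pi; have /andP[i2 /eqP oi] := h2 i pi.
have ni : i != n.+2 by apply: contraNneq pi => ->; rewrite p0.
move: oi; rewrite /= negbK => oi; rewrite oi eqxx andbT.
have : i != n.+1 by apply/eqP => E; move: oi; rewrite E /=; case: odd.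
by lia.
Qed.

Lemma tclos_admissible n : (0 < n)%N -> admissible n (tclos n).
Proof.
case: n => // n _; apply: admissibleZ; last by apply: skein_admissible; rewrite ?spiral_wf.
by apply/laurentX/laurentN/laurentX/laurentA.
Qed.

(** The leading coefficient of $t^n$ is a unit of $\mathbb{Z}[A^{\pm1}]$, so division by it stays
    within Laurent polynomials. *)
Lemma tclos_cancel n p : (0 < n)%N -> admissible n p ->
  exists2 c, laurent c & admissible n (p - c *: tclos n) /\ (p - c *: tclos n)`_n = 0.
Proof.
move=> n0 hp; have [lp _ _] := hp.
have lu : laurent ((- Avar^-1 ^+ 2) ^+ n.-1).
  by apply/laurentX/laurentN/laurentX/laurentAV.
exists (p`_n * (- Avar^-1 ^+ 2) ^+ n.-1); first exact: laurentM.
split.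
  apply: admissibleB => //; apply: admissibleZ; [exact: laurentM|exact: tclos_admissible].
rewrite coefB coefZ tclos_lead // -mulrA -exprMn mulrNN -exprMn mulVf ?Avar_neq0 //.
by rewrite !expr1n mulr1 subrr.
Qed.

Lemma tclos_span n p : (0 < n)%N -> admissible n p -> p`_n = 0 ->
  exists a : nat -> KA, (forall i, laurent (a i)) /\
    p = \sum_(0 <= i < n./2) a i *: tclos (2 * i + odd n).
Proof.
elim/ltn_ind: n p => -[//|[|[|k]]] IH p _ hp pn.
- exists (fun=> 0); split=> [_|]; first exact: laurent0.
  rewrite big_geq //; apply/polyP => i; rewrite coef0.
  apply/eqP; apply/negPn/negP => pi; have [_ h _] := hp.
  have /andP[i1 /eqP oi] := h i pi.
  by case: i i1 oi pi => [|[|]] //; rewrite pn eqxx.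
(* For $n=2$ only the constant term is left, a multiple of [delta], which is $t^0$. *)
- have [_ h [c lc p0]] := admissible_lower hp pn.
  exists (fun=> c); split=> //.
  rewrite big_nat1 -[tclos _]/(tclos 0) tclos0; apply/polyP => i; rewrite coefZ coefC.
  case: eqP => [->//|/eqP i0]; rewrite mulr0; apply/eqP/negPn/negP => /h.
  by rewrite leqn0 (negPf i0).
have hk := admissible_lower hp pn.
have [c lc [hq qn]] := tclos_cancel (ltn0Sn k) hk.
have [a [la E]] := IH k.+1 (leqnSn k.+2) _ (ltn0Sn k) hq qn.
exists (fun i => if i == k.+1./2 then c else a i); split.
  by move=> i; case: ifP.
rewrite -[(k.+3)./2]/(k.+1./2.+1) big_nat_recr //= eqxx.
rewrite -[LHS](subrK (c *: tclos k.+1)) E; congr (_ + _).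
  apply: eq_big_nat => i /andP[_ ik].
  by rewrite (ltn_eqF ik) /= !negbK.
congr (_ *: tclos _); rewrite negbK -[in LHS](odd_double_half k.+1) /=; lia.
Qed.

Theorem theorem9 :
  (forall n : nat, (1 <= n)%N ->
    exists a : nat -> KA, (forall i, laurent (a i)) /\
      band_rels ((1 - Avar ^+ (2 * n + 4)) *: tclos n -
        (if ~~ odd n then \sum_(0 <= i < n./2) a i *: tclos (2 * i)
         else \sum_(0 <= i < n./2) a i *: tclos (2 * i + 1))))
  /\ band_rels ((1 - Avar ^+ 6) *: tclos 1).
Proof.
suff H n : (1 <= n)%N -> exists a : nat -> KA, (forall i, laurent (a i)) /\
      band_rels ((1 - Avar ^+ (2 * n + 4)) *: tclos n -
        (if ~~ odd n then \sum_(0 <= i < n./2) a i *: tclos (2 * i)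
         else \sum_(0 <= i < n./2) a i *: tclos (2 * i + 1))).
  split; first exact: H.
  (* For $n=1$ the sum is empty and the exponent computes to 6. *)
  by have [a [_]] := H 1%N isT; rewrite !big_geq // subr0.
move=> n0; have lA k : laurent (Avar ^+ k) by apply/laurentX/laurentA.
(* [u] is the leading coefficient of $t^n$; the relation for $n$ parallel cores has leading
   coefficient $1-A^{2n+4}$, so the $z^n$ terms of [p] cancel. *)
pose u : KA := (- Avar ^+ 2) ^+ n.-1; have lu : laurent u by apply/laurentX/laurentN.
have rel : slide_rel n [::] true = skein n [::] - skein n (slide n true).
  by rewrite /slide_rel n0 /closable /= eqxx cats0.
pose p := (1 - Avar ^+ (2 * n + 4)) *: tclos n - u *: slide_rel n [::] true.
have hp : admissible n p.
  apply: admissibleB; apply: admissibleZ => //.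
  - by apply: laurentD; [exact: laurent1|apply: laurentN].
  - exact: tclos_admissible.
  - by rewrite rel; apply: admissibleB; apply: skein_admissible; rewrite ?slide_wf.
have pn : p`_n = 0.
  rewrite coefB !coefZ tclos_lead // rel coefB skein_nil_lead skein_slide_lead //.
  by rewrite mulrC subrr.
have [a [la E]] := tclos_span n0 hp pn; exists a; split=> //.
exists [:: (u, (n, [::], true))]; split; first by constructor.
rewrite big_seq1 /=.
have -> : (if ~~ odd n then \sum_(0 <= i < n./2) a i *: tclos (2 * i)
   else \sum_(0 <= i < n./2) a i *: tclos (2 * i + 1)) = p.
  rewrite E; case: odd => //=; apply: eq_bigr => i _; by rewrite addn0.
by rewrite /p opprB addrC subrK.
Qed.
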